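(* Let Assumptions A1–A5 (stated in the context) hold, let $\{x_k\}$ be a sequence generated by Algorithm IR-NS, and suppose there is a constant $\overline{\alpha}>0$ such that $\alpha_k\ge\overline{\alpha}$ for all $k\in\mathbb{N}$. Then every strictly strong accumulation point $x^*$ of the sequence $\{x_k\}$ is a solution of the problem $\min_{x\in\mathbb{R}^n} f(x)$ almost surely, i.e. $f(x^* )=\inf_{y\in\mathbb{R}^n} f(y)$ a.s.
   Context: A point $x^*$ is a strictly strong accumulation point of $\{x_k\}_{k\in\mathbb{N}}$ if there exist an infinite subset $K=\{k_1<k_2<\dots\}\subseteq\mathbb{N}$ and a constant $b\in\mathbb{N}$ such that $\lim_{i\to\infty}x_{k_i}=x^*$ and $k_{i+1}-k_i\le b$ for any two consecutive elements $k_i,k_{i+1}$ of $K$. Problem: $\min_{x\in\mathbb{R}^n} f(x)=E[F(x,\xi)]$, where $F:\mathbb{R}^n\times\mathbb{R}^m\to\mathbb{R}$ is continuous and convex in $x$ and bounded from below, $\xi:\Omega\to\mathbb{R}^m$ is a random vector on a probability space $(\Omega,\mathcal{F},P)$. For an i.i.d. sample $\xi_1,\dots,\xi_N$ of $\xi$, the sample average approximation (SAA) is $f_N(x)=\frac1N\sum_{i=1}^N f_i(x)$, $f_i(x)=F(x,\xi_i)$. $\partial f_N(x)$ is the convex subdifferential. The function $h:\mathbb{N}\to[0,\infty)$ is a fixed monotonically decreasing function with $\lim_{N\to\infty}h(N)=0$. The merit function is $\Phi(x,N,\theta)=\theta f_N(x)+(1-\theta)h(N)$, $\theta\in(0,1)$.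 Algorithm IR-NS. S0: Given $x_0\in\mathbb{R}^n$, $N_0\in\mathbb{N}$, $\theta_0,r\in(0,1)$, $\beta,\gamma,\overline{\gamma}>0$. Set $k=0$. S1: Find $\tilde N_{k+1}\ge N_k$ such that $h(\tilde N_{k+1})\le r\,h(N_k)$ and (R) $f_{\tilde N_{k+1}}(x_k)-f_{N_k}(x_k)\le\beta h(N_k)$. S2: If $\Phi(x_k,\tilde N_{k+1},\theta_k)-\Phi(x_k,N_k,\theta_k)\le\frac{1-r}{2}\big(h(\tilde N_{k+1})-h(N_k)\big)$ set $\theta_{k+1}=\theta_k$; else $\theta_{k+1}=\frac{(1+r)(h(N_k)-h(\tilde N_{k+1}))}{2[f_{\tilde N_{k+1}}(x_k)-f_{N_k}(x_k)+h(N_k)-h(\tilde N_{k+1})]}$. S3: Choose $N_{k+1}\le\tilde N_{k+1}$, a direction $p_{N_{k+1}}(x_k)\in\mathbb{R}^n$ (of the type in Assumption A2) and $\alpha_k\in(0,1]$ such that (i) $f_{N_{k+1}}(x_k+\alpha_kp_{N_{k+1}}(x_k))-f_{\tilde N_{k+1}}(x_k)\le-\gamma\alpha_k\|p_{N_{k+1}}(x_k)\|^2$, (ii) $h(N_{k+1})\le h(\tilde N_{k+1})+\overline{\gamma}\alpha_k^2\|p_{N_{k+1}}(x_k)\|^2$, (iii) $\Phi(x_k+\alpha_kp_{N_{k+1}}(x_k),N_{k+1},\theta_{k+1})-\Phi(x_k,N_k,\theta_{k+1})\le\frac{1-r}{2}\big(h(\tilde N_{k+1})-h(N_k)\big)$.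 S4: Set $p_k=p_{N_{k+1}}(x_k)$, $x_{k+1}=x_k+\alpha_kp_k$, $k:=k+1$, go to S1. Sampling: the SAA functions use i.i.d. samples. In S1 a random sample is generated for $f_{\tilde N_{k+1}}$; in S3 the sample for $f_{N_{k+1}}$ may differ from it. With $\mathcal{F}_k$ the $\sigma$-algebra generated by $x_0,\dots,x_k$, one has $E[f_{\tilde N_{k+1}}(x_k)\mid\mathcal{F}_k]=f(x_k)$ and $E[f_{N_{k+1}}(x_k)\mid\mathcal{F}_k]=f(x_k)$. Assumptions. A1: the functions $f_i(x)=F(x,\xi_i)$, $i=1,2,\dots$, are continuous, convex and bounded from below by a constant $C$ for all $\xi_i$. A2: for any given $N$, $x$ and $B$ such that $mI\preceq B(x)\preceq MI$, for some positive bounded constants $m\le M$, one can compute a direction $p_N(x)\in\mathbb{R}^n$ such that $p_N(x)=-B(x)\bar g_N(x)$ and $\sup_{g\in\partial f_N(x)}g^Tp_N(x)\le-\frac m2\|\bar g_N(x)\|^2$, where $\bar g_N(x)\in\partial f_N(x)$. A3: there exists $\beta$ such that (R) holds for each $k$. A4: $f$ has bounded level sets. A5: $F$ is dominated by an integrable function on a bounded open set $\tilde D^0$ with $D\subset\tilde D^0$. Here $D=\{x\in\mathbb{R}^n: f(x)\le C_2\}$, $C_2=C_0+2\beta C_1$, where $C_0$ is a constant with $F(x_0,\xi)\le C_0$ for any $\xi$ (assumed to exist) and $C_1>0$ is a constant with $\sum_{k=0}^\infty h(N_k)\le C_1<\infty$ (such a constant exists for Algorithm IR-NS by a known result). *)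

(* Defs.v *)
From HB Require Import structures.
From mathcomp Require Import all_boot all_order all_algebra finmap.
From mathcomp Require Import all_classical all_reals all_analysis measurable_realfun.
Import Order.TTheory GRing.Theory Num.Theory.
Import numFieldNormedType.Exports.

Set Implicit Arguments.
Unset Strict Implicit.
Unset Printing Implicit Defensive.

Local Open Scope classical_set_scope.
Local Open Scope ring_scope.

(* R^n is 'rV[R]_n. Its library norm is the sup norm, so the Euclidean
   structure is written with [dot]; topology and boundedness do not depend on
   the choice. The Borel sigma-algebra of R^n is generated by the open sets. *)
Notation borel R n := (g_sigma_algebraType (@open 'rV[R]_n)).

Section Euclidean.
Context {R : realType} {n : nat}.
Implicit Types (u v x g p : 'rV[R]_n) (B : 'M[R]_n).

Definition dot u v : R := \sum_(i < n) u ord0 i * v ord0 i.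

Definition norm2 u : R := Num.sqrt (dot u u).

Definition mulmv B v : 'rV[R]_n := (B *m v^T)^T.

Definition psd B : Prop := B^T = B /\ forall v, 0 <= dot v (mulmv B v).

Definition loewner_le A B : Prop := psd (B - A).

Definition subdiff (phi : 'rV[R]_n -> R) x : set 'rV[R]_n :=
  [set g | forall y, phi x + dot g (y - x) <= phi y].

(* p = - B gbar, where gbar is a subgradient of phi at x and
   sup_{g in subdiff phi x} g^T p <= - (mB / 2) |gbar|^2. *)
Definition descent_direction (mB : R) (phi : 'rV[R]_n -> R) x B p : Prop :=
  exists2 gbar, subdiff phi x gbar &
    p = - mulmv B gbar /\
    (ereal_sup [set (dot g p)%:E | g in subdiff phi x]
       <= (- (mB / 2) * norm2 gbar ^+ 2)%:E)%E.

Definition strictly_strong_accumulation_point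
    (x : nat -> 'rV[R]_n) (xs : 'rV[R]_n) : Prop :=
  exists (k : nat -> nat) (b : nat),
    [/\ forall i, (k i < k i.+1)%N,
        x (k i) @[i --> \oo] --> xs &
        forall i, (k i.+1 - k i <= b)%N].

End Euclidean.

Section Probability.
Context {d : measure_display} {T : measurableType d} {R : realType}.
Variable P : probability T R.

Definition random_vector {n : nat} (X : T -> 'rV[R]_n) : Prop :=
  measurable_fun setT (X : T -> borel R n).

Definition iid_sample {n : nat} (xi : T -> 'rV[R]_n)
    (Y : nat -> T -> 'rV[R]_n) : Prop :=
  [/\ forall i, random_vector (Y i),
      forall i (A : set (borel R n)), measurable A ->
        P (Y i @^-1` A) = P (xi @^-1` A) &
      forall (J : {fset nat}) (A : nat -> set (borel R n)),
        (forall i, measurable (A i)) ->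
        P (\bigcap_(i in [set` J]) (Y i @^-1` A i))
          = (\prod_(i <- J) P (Y i @^-1` A i))%E].

Definition natural_filtration {n : nat} (x : nat -> T -> 'rV[R]_n) (k : nat) :
    set (set T) :=
  <<s \bigcup_(i in `I_k.+1)
        preimage_set_system setT (x i : T -> borel R n) measurable >>.

(* Y is a version of the conditional expectation E[X | G]. *)
Definition is_cond_expectation (G : set (set T)) (X Y : T -> \bar R) : Prop :=
  [/\ P.-integrable setT X, P.-integrable setT Y,
      forall B : set \bar R, measurable B -> G (Y @^-1` B) &
      forall A, G A -> (\int[P]_(w in A) X w = \int[P]_(w in A) Y w)%E].

End Probability.

Section Problem.
Context {R : realType} {n q : nat}.
Variable F : 'rV[R]_n -> 'rV[R]_q -> R.

(* Extended-real valued: F is bounded below, and E[F(x, xi)] = +oo is not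
   excluded where no domination is assumed. *)
Definition objective {d : measure_display} {T : measurableType d}
    (P : probability T R) (xi : T -> 'rV[R]_q) (x : 'rV[R]_n) : \bar R :=
  'E_P[fun w => F x (xi w)].

(* The sample xi_1, xi_2, ... is indexed from 0: z i stands for xi_{i+1}. *)
Definition saa (z : nat -> 'rV[R]_q) (N : nat) (x : 'rV[R]_n) : R :=
  N%:R^-1 * \sum_(i < N) F x (z i).

Definition merit (h : nat -> R) (z : nat -> 'rV[R]_q)
    (x : 'rV[R]_n) (N : nat) (theta : R) : R :=
  theta * saa z N x + (1 - theta) * h N.

Definition assumption_A1 (C : R) : Prop :=
  forall z, [/\ continuous (F ^~ z),
                convex_function [set: 'rV[R]_n] (F ^~ z) &
                forall x, C <= F x z].

Definition assumption_A2 (mB MB : R) : Prop :=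
  0 < mB <= MB /\
  forall (z : nat -> 'rV[R]_q) (N : nat) (x : 'rV[R]_n) (B : 'M[R]_n),
    (0 < N)%N -> loewner_le mB%:M B -> loewner_le B MB%:M ->
    exists p, descent_direction mB (saa z N) x B p.

(* One realization of the algorithm. z k is the realized sample defining
   f_{N_k} (drawn in S3 of iteration k - 1, and initially for k = 0), and
   zt k.+1 the one defining f_{Nt_{k+1}} (drawn in S1 of iteration k); Nt 0 and
   zt 0 are not used. *)
Definition condition_R (h : nat -> R) (beta : R)
    (x : nat -> 'rV[R]_n) (N Nt : nat -> nat)
    (z zt : nat -> nat -> 'rV[R]_q) (k : nat) : Prop :=
  saa (zt k.+1) (Nt k.+1) (x k) - saa (z k) (N k) (x k) <= beta * h (N k).

Record IR_NS (h : nat -> R) (r beta gamma gammabar mB MB : R)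
    (x0 : 'rV[R]_n) (N0 : nat) (theta0 : R)
    (x : nat -> 'rV[R]_n) (N Nt : nat -> nat) (theta alpha : nat -> R)
    (p : nat -> 'rV[R]_n) (z zt : nat -> nat -> 'rV[R]_q) : Prop := {
  S0_init : [/\ x 0%N = x0, N 0%N = N0 & theta 0%N = theta0] ;
  S1_restoration : forall k,
    [/\ (N k <= Nt k.+1)%N, h (Nt k.+1) <= r * h (N k) &
        condition_R h beta x N Nt z zt k] ;
  S2_penalty : forall k,
    theta k.+1 =
      if merit h (zt k.+1) (x k) (Nt k.+1) (theta k)
           - merit h (z k) (x k) (N k) (theta k)
           <= (1 - r) / 2 * (h (Nt k.+1) - h (N k))
      then theta k
      else (1 + r) * (h (N k) - h (Nt k.+1))
           / (2 * (saa (zt k.+1) (Nt k.+1) (x k) - saa (z k) (N k) (x k)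
                   + h (N k) - h (Nt k.+1))) ;
  S3_sizes : forall k, (0 < N k.+1 <= Nt k.+1)%N ;
  S3_direction : forall k, exists2 B : 'M[R]_n,
    loewner_le mB%:M B /\ loewner_le B MB%:M &
    descent_direction mB (saa (z k.+1) (N k.+1)) (x k) B (p k) ;
  S3_step : forall k, 0 < alpha k <= 1 ;
  S3_i : forall k,
    saa (z k.+1) (N k.+1) (x k + alpha k *: p k)
      - saa (zt k.+1) (Nt k.+1) (x k)
    <= - gamma * alpha k * norm2 (p k) ^+ 2 ;
  S3_ii : forall k,
    h (N k.+1) <= h (Nt k.+1) + gammabar * alpha k ^+ 2 * norm2 (p k) ^+ 2 ;
  S3_iii : forall k,
    merit h (z k.+1) (x k + alpha k *: p k) (N k.+1) (theta k.+1)
      - merit h (z k) (x k) (N k) (theta k.+1)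
    <= (1 - r) / 2 * (h (Nt k.+1) - h (N k)) ;
  S4_update : forall k, x k.+1 = x k + alpha k *: p k
}.

End Problem.

Section Assumptions.
Context {R : realType} {n q : nat} {d : measure_display} {T : measurableType d}.
Variables (P : probability T R) (F : 'rV[R]_n -> 'rV[R]_q -> R).
Variable xi : T -> 'rV[R]_q.

Definition assumption_A4 : Prop :=
  forall c : R, bounded_set [set x | (objective F P xi x <= c%:E)%E].

Definition assumption_A5 (D : set 'rV[R]_n) : Prop :=
  exists (D0 : set 'rV[R]_n) (G : 'rV[R]_q -> R),
    [/\ open D0, bounded_set D0, D `<=` D0,
        P.-integrable setT (fun w => (G (xi w))%:E) &
        {ae P, forall w, forall x, D0 x -> `|F x (xi w)| <= G (xi w)}].

End Assumptions.

(* Main.v *)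
(** Along a run, the descent condition (i), restoration (R) and the
    summability of [h (N k)] telescope to [sum |p_k|^2 < oo]. Hence the steps
    vanish, and the bounded gaps of a strictly strong accumulation point [x*]
    force the whole sequence [x_k] to converge to [x*]; the subgradients [g_k]
    of [f_{N_{k+1}}] at [x_k] tend to 0 as well, and [N_k] tends to infinity.

    The samples of different iterations may depend on each other, and the
    sample sizes may depend on the samples, so the law of large numbers is
    needed in a form that is uniform in [N >= M] with a bound on the exceptional
    probability depending only on the common law: it then holds at infinitely
    many iterations almost surely, simultaneously for two test functions.

    If [f y < f x*], one may take [y] in [D] (replace it by [x_0] when
    [f x* > C_0]), and by dominated convergence even at a rational point. The
    two test functions are [F(y, .)] and a truncated infimum of [F] over a small
    rational ball around [x*], whose expectation exceeds [f y] by Fatou's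
    lemma; at a good iteration they contradict
    [f_N(y) >= f_N(x_k) + g_k . (y - x_k)]. *)

Require Import Defs.
From mathcomp Require Import all_boot all_order all_algebra finmap.
From mathcomp Require Import all_classical all_reals all_analysis measurable_realfun.
From HB Require Import structures.
From mathcomp Require Import ring lra zify.
Import Order.TTheory GRing.Theory Num.Theory.
Import numFieldNormedType.Exports.

Local Open Scope classical_set_scope.
Local Open Scope ring_scope.

Set Implicit Arguments.
Unset Strict Implicit.
Unset Printing Implicit Defensive.

(** * Expectation of a product of independent variables *)

Section independent_products.
Context {d : measure_display} {T : measurableType d} {R : realType}.
Variable P : probability T R.

(** Independence identifies the law of the pair with the product of the marginal laws, since both
    agree on rectangles; Tonelli then factors the integral. *)
Lemma ge0_expectationM_indep (X Y : {RV P >-> R}) :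
  (forall w, 0 <= X w) -> (forall w, 0 <= Y w) ->
  (forall A B, measurable A -> measurable B ->
    P (X @^-1` A `&` Y @^-1` B) = (P (X @^-1` A) * P (Y @^-1` B))%E) ->
  ('E_P[X \* Y] = 'E_P[X] * 'E_P[Y])%E.
Proof.
move=> X0 Y0 indep.
pose XY w := (X w, Y w).
have mXY : measurable_fun setT XY by exact: measurable_fun_pair.
pose XYm : {mfun T >-> (R * R)%type} := HB.pack XY (isMeasurableFun.Build _ _ _ _ _ mXY).
(* The absolute values make the integrand nonnegative on the whole plane, as Tonelli requires; they
   change nothing at the values of [XY]. *)
pose f (z : R * R) : \bar R := (`|z.1| * `|z.2|)%:E.
have mf : measurable_fun setT f.
  apply/measurable_EFinP; apply: measurable_funM; apply: measurableT_comp => //.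
have f0 z : (0 <= f z)%E by rewrite lee_fin mulr_ge0.
have E_abs (Z : {RV P >-> R}) : (forall w, 0 <= Z w) ->
    (\int[distribution P Z]_y `|y|%:E = 'E_P[Z])%E.
  move=> Z0; rewrite ge0_integral_distribution//; last exact/measurable_EFinP.
  rewrite unlock; apply: eq_integral => w _ /=; by rewrite ger0_norm.
have mabs : measurable_fun setT (fun y : R => `|y|%:E) by exact/measurable_EFinP.
transitivity (\int[distribution P XYm]_z f z)%E.
  rewrite ge0_integral_distribution// unlock; apply: eq_integral => w _ /=.
  by rewrite /f /= !ger0_norm.
transitivity (\int[distribution P X \x distribution P Y]_z f z)%E.
  apply: eq_measure_integral => A mA _; apply/esym.
  exact: product_measure_unique.
rewrite fubini_tonelli1//= /fubini_F /f /=.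
under eq_integral => x _.
  under eq_integral do rewrite EFinM.
  rewrite ge0_integralZl//= E_abs//.
  over.
rewrite ge0_integralZr//= ?E_abs//.
exact: expectation_ge0.
Qed.

End independent_products.

(** * Variance and Chebyshev estimates for pairwise i.i.d. sequences *)

Section pairwise_iid.
Context {d : measure_display} {T : measurableType d} {R : realType}.
Variable P : probability T R.

(** Pairwise independence is what a variance computation uses. The arbitrary target type lets the
    notion pass from vector samples to their real images. *)
Definition pairwise_iid {d'} {U : measurableType d'} (V : T -> U)
    (X : nat -> T -> U) : Prop :=
  [/\ forall i, measurable_fun setT (X i),
      forall i A, measurable A -> P (X i @^-1` A) = P (V @^-1` A) &
      forall i j A B, i != j -> measurable A -> measurable B ->
        P (X i @^-1` A `&` X j @^-1` B)
          = (P (X i @^-1` A) * P (X j @^-1` B))%E].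

Lemma measurable_preimageT {d'} {U : measurableType d'} (f : T -> U) A :
  measurable_fun setT f -> measurable A -> measurable (f @^-1` A).
Proof. by move=> mf mA; rewrite -[X in measurable X]setTI; exact: mf. Qed.

Lemma pairwise_iid_comp {d1 d2} {U1 : measurableType d1}
    {U2 : measurableType d2} (f : U1 -> U2) V X :
  measurable_fun setT f -> pairwise_iid V X ->
  pairwise_iid (f \o V) (fun i => f \o X i).
Proof.
move=> mf [mX lawX indX]; have mpf A : measurable A -> measurable (f @^-1` A).
  by move=> mA; rewrite -[X in measurable X]setTI; exact: mf.
split => [i|i A mA|i j A B ij mA mB].
- exact: measurableT_comp.
- exact: (lawX i _ (mpf _ mA)).
- exact: (indX i j _ _ ij (mpf _ mA) (mpf _ mB)).
Qed.

Lemma eq_law_integral (V X : T -> R) (f : R -> \bar R) :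
  measurable_fun setT V -> measurable_fun setT X ->
  (forall A, measurable A -> P (X @^-1` A) = P (V @^-1` A)) ->
  measurable_fun setT f -> (forall y, 0 <= f y)%E ->
  (\int[P]_w f (X w) = \int[P]_w f (V w))%E.
Proof.
move=> mV mX XV mf f0.
pose Xm : {RV P >-> R} := HB.pack X (isMeasurableFun.Build _ _ _ _ _ mX).
pose Vm : {RV P >-> R} := HB.pack V (isMeasurableFun.Build _ _ _ _ _ mV).
have <- := @ge0_integral_distribution _ _ _ _ _ P Xm f mf f0.
have <- := @ge0_integral_distribution _ _ _ _ _ P Vm f mf f0.
by apply: eq_measure_integral => A mA _; exact: XV.
Qed.

Lemma bounded_Lfun2 (X : T -> R) K : measurable_fun setT X ->
  (forall w, `|X w| <= K) -> X \in Lfun P 2%:E.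
Proof.
move=> mX XK; rewrite inE; apply/andP; split; rewrite inE//=.
rewrite /finite_norm unlock /= poweR_lty//.
apply: le_lt_trans (_ : \int[P]_x (K `^ 2)%:E < +oo)%E; last first.
  rewrite integral_cst// lte_mul_pinfty ?lee_fin ?powR_ge0//.
  by rewrite -ge0_fin_numE ?measure_ge0// fin_num_measure.
apply: ge0_le_integral => //.
- apply/measurable_EFinP; apply: (@measurableT_comp _ _ _ _ _ _ (@powR R ^~ 2)) => //.
  exact: measurableT_comp.
- move=> w _; rewrite lee_fin ge0_ler_powR// nnegrE //.
  by rewrite (le_trans _ (XK w)).
Qed.

Lemma pairwise_iid_covariance0 (V : T -> R) (X : nat -> T -> R) K i j :
  pairwise_iid V X -> (forall i w, 0 <= X i w <= K) -> i != j ->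
  covariance P (X i) (X j) = 0%E.
Proof.
move=> [mX lawX indX] XK ij.
have X2 k : X k \in Lfun P 2%:E.
  apply: (@bounded_Lfun2 _ K) => // w.
  by have /andP[X0 XK'] := XK k w; rewrite ger0_norm.
have X1 k : X k \in Lfun P 1.
  by apply: (Lfun_subset12 _ (X2 k)); exact: fin_num_measure.
rewrite covarianceE//; last exact: Lfun2_mul_Lfun1.
pose Xm k : {RV P >-> R} := HB.pack (X k) (isMeasurableFun.Build _ _ _ _ _ (mX k)).
have := @ge0_expectationM_indep _ _ _ P (Xm i) (Xm j).
rewrite /= => ->.
- by rewrite subee// fin_numM// expectation_fin_num.
- by move=> w; have /andP[] := XK i w.
- by move=> w; have /andP[] := XK j w.
- by move=> A B mA mB; exact: indX.
Qed.

(** Vanishing covariances make the variance additive, and each variance is at most a second moment.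
    The bound [K] secures finite second moments but stays out of the estimate, so it may grow with
    [m] under truncation. *)
Lemma pairwise_iid_variance_sum (V : T -> R) (X : nat -> T -> R) K m :
  measurable_fun setT V ->
  pairwise_iid V X -> (forall i w, 0 <= X i w <= K) ->
  ('V_P[(fun w => \sum_(i < m) X i w)%R] <= (m%:R)%:E * \int[P]_w (V w ^+ 2)%:E)%E.
Proof.
move=> mV iidX XK; have [mX lawX indX] := iidX.
have X2 k : X k \in Lfun P 2%:E.
  apply: (@bounded_Lfun2 _ K) => // w.
  by have /andP[X0 XK'] := XK k w; rewrite ger0_norm.
have S2 l : (fun w => \sum_(i < l) X i w) \in Lfun P 2%:E.
  rewrite (_ : (fun _ => _) = \sum_(i < l) X i); first by rewrite rpred_sum ?lee1n.
  by apply/funext => w; rewrite fct_sumE.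
(* A partial sum is uncorrelated with every later term, so variances add up in the induction on
   [m]. *)
have cov0 l k : (l <= k)%N -> covariance P (fun w => \sum_(i < l) X i w) (X k) = 0%E.
  elim: l => [_|l IH lk].
    rewrite (_ : (fun _ => _) = cst 0) ?covariance_cst_l//.
    by apply/funext => w; rewrite big_ord0.
  rewrite (_ : (fun _ => _) = (fun w => \sum_(i < l) X i w) \+ X l); last first.
    by apply/funext => w; rewrite big_ord_recr.
  rewrite covarianceDl// IH ?(ltnW lk)// (pairwise_iid_covariance0 iidX XK) ?adde0//.
  by rewrite neq_ltn lk.
elim: m => [|m IH].
  rewrite (_ : (fun _ => _) = cst 0) ?variance_cst ?mul0e//.
  by apply/funext => w; rewrite big_ord0.
rewrite (_ : (fun _ => _) = (fun w => \sum_(i < m) X i w) \+ X m); last first.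
  by apply/funext => w; rewrite big_ord_recr.
rewrite varianceD// cov0// mule0 adde0.
rewrite -natr1 EFinD ge0_muleDl ?lee_fin// mul1e leeD//.
have := @eq_law_integral V (X m) (fun y => (y ^+ 2)%:E) mV (mX m) (lawX m).
move=> <-; last 2 first.
- by apply/measurable_EFinP; exact: measurable_funX.
- by move=> y; rewrite lee_fin sqr_ge0.
have -> : (\int[P]_w (X m w ^+ 2)%:E = 'E_P[X m ^+ 2])%E by rewrite unlock.
rewrite varianceE// leeBlDr; last first.
  rewrite fin_numX// expectation_fin_num//.
  by apply: (Lfun_subset12 _ (X2 m)); exact: fin_num_measure.
by apply: leeDl; rewrite sqre_ge0.
Qed.

Lemma pairwise_iid_chebyshev (V : T -> R) (X : nat -> T -> R) K m (e : R) :
  measurable_fun setT V -> (forall w, 0 <= V w) ->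
  pairwise_iid V X -> (forall i w, 0 <= X i w <= K) -> (0 < m)%N -> 0 < e ->
  (P [set w | (m%:R * e <= `|\sum_(i < m) X i w - m%:R * fine (\int[P]_w (V w)%:E)%E|)%R]
    <= (m%:R * e ^+ 2)^-1%:E * \int[P]_w (V w ^+ 2)%:E)%E.
Proof.
move=> mV V0 iidX XK m0 e0; have [mX lawX indX] := iidX.
have X2 k : X k \in Lfun P 2%:E.
  apply: (@bounded_Lfun2 _ K) => // w.
  by have /andP[X0 XK'] := XK k w; rewrite ger0_norm.
have X1 k : X k \in Lfun P 1.
  by apply: (Lfun_subset12 _ (X2 k)); exact: fin_num_measure.
have mS : measurable_fun setT (fun w => \sum_(i < m) X i w).
  exact: measurable_sum.
pose S : {RV P >-> R} := HB.pack (fun w => \sum_(i < m) X i w)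
  (isMeasurableFun.Build _ _ _ _ _ mS).
have EX k : ('E_P[X k])%E = (\int[P]_w (V w)%:E)%E.
  transitivity (\int[P]_w `|V w|%:E)%E; last first.
    by apply: eq_integral => w _; rewrite ger0_norm.
  rewrite -(@eq_law_integral V (X k) (fun y => `|y|%:E) mV (mX k) (lawX k))//.
    by rewrite unlock; apply: eq_integral => w _; rewrite ger0_norm//; case/andP: (XK k w).
  exact/measurable_EFinP.
have EVfin : (\int[P]_w (V w)%:E)%E \is a fin_num.
  by rewrite -(EX 0%N) expectation_fin_num.
have ES : ('E_P[S])%E = (m%:R * fine (\int[P]_w (V w)%:E)%E)%:E.
  rewrite /S /= {mS S}.
  rewrite (_ : (fun _ => _) = \sum_(f <- [seq X (val i) | i <- index_enum 'I_m]) f); last first.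
    by apply/funext => w; rewrite big_map fct_sumE.
  rewrite expectation_sum; last by move=> f /mapP[i _ ->]; exact: X1.
  rewrite big_map (eq_bigr (fun=> (fine (\int[P]_w (V w)%:E)%E)%:E)); last first.
    by move=> i _; rewrite fineK// EX.
  by rewrite sumEFin sumr_const card_ord mulr_natl.
have me : 0 < m%:R * e by rewrite mulr_gt0// ltr0n.
have := chebyshev S me; rewrite ES /=.
move/le_trans; apply.
apply: (@le_trans _ _ (((m%:R * e) ^- 2)%:E * (m%:R%:E * \int[P]_w (V w ^+ 2)%:E))%E).
  rewrite lee_wpmul2l//; last exact: pairwise_iid_variance_sum iidX XK.
  by rewrite lee_fin invr_ge0 exprn_ge0// ltW.
rewrite muleA -EFinM; apply: lee_wpmul2r.
  by apply: integral_ge0 => w _; rewrite lee_fin sqr_ge0.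
rewrite lee_fin le_eqVlt; apply/orP; left; apply/eqP; field.
by rewrite pnatr_eq0 -lt0n m0 gt_eqF.
Qed.

End pairwise_iid.

(** * Deterministic estimates along dyadic sizes *)

Section strong_law.
Context {R : realType}.

(* The sizes [c * 2 ^ j] with [L <= c <= 2L] have consecutive ratios at most
   [1 + 1/L], and partial sums of nonnegative terms are monotone. *)
Lemma dyadic_average_interpolation (x : nat -> R) (mu eps : R) (L A N : nat) :
  (forall i, 0 <= x i) -> 0 <= mu -> 0 < eps -> (0 < L)%N ->
  mu + eps <= eps * L%:R ->
  (forall c j, (L <= c <= L.*2)%N -> (A <= j)%N ->
    `|\sum_(i < c * 2 ^ j) x i - (c * 2 ^ j)%:R * mu| <= (c * 2 ^ j)%:R * eps) ->
  (L * 2 ^ A <= N)%N ->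
  `|N%:R^-1 * \sum_(i < N) x i - mu| <= 2 * eps.
Proof.
move=> x0 mu0 eps0 L0 muL H LN.
have N0 : (0 < N)%N by rewrite (leq_trans _ LN)// muln_gt0 L0 expn_gt0.
have AL : (2 ^ A <= N %/ L)%N by rewrite leq_divRL// mulnC.
have NL0 : (0 < N %/ L)%N by rewrite (leq_trans _ AL)// expn_gt0.
(* At scale [t = 2 ^ a] one has [L * t <= N < L.*2 * t], so the quotient [c] satisfies
   [L <= c < L.*2], and [H] covers both [c] and [c.+1]. *)
pose a := trunc_log 2 (N %/ L).
have /andP[a1 a2] := trunc_log_bounds (isT : (1 < 2)%N) NL0.
rewrite -/a in a1 a2.
have Aa : (A <= a)%N.
  by rewrite -ltnS -(ltn_exp2l _ _ (isT : (1 < 2)%N)) (leq_ltn_trans AL a2).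
pose t := (2 ^ a)%N.
have t0 : (0 < t)%N by rewrite expn_gt0.
pose c := (N %/ t)%N.
have LtN : (L * t <= N)%N.
  by rewrite mulnC -leq_divRL.
have N2Lt : (N < L.*2 * t)%N.
  move: a2; rewrite ltn_divLR// expnS => /leq_trans; apply.
  by rewrite -mul2n -/t; lia.
have Lc : (L <= c)%N by rewrite leq_divRL.
have cL : (c < L.*2)%N by rewrite ltn_divLR.
have ctN : (c * t <= N)%N by exact: leq_trunc_div.
have Nct : (N <= c.+1 * t)%N by rewrite ltnW// ltn_ceil.
have Smono p q : (p <= q)%N -> \sum_(i < p) x i <= \sum_(i < q) x i.
  move=> pq; rewrite -(big_mkord xpredT x) -(big_mkord xpredT x).
  rewrite (big_cat_nat (leq0n p) pq)//= lerDl; exact: sumr_ge0.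
have h1 := H c a _ Aa; have h2 := H c.+1 a _ Aa.
move: h1 h2; rewrite -!/t Lc (ltnW cL) cL leqW// => /(_ isT) h1 /(_ isT) h2.
have s1 := Smono _ _ ctN; have s2 := Smono _ _ Nct.
rewrite ler_norml in h1; rewrite ler_norml in h2.
move/andP: h1 => [h1 _]; move/andP: h2 => [_ h2].
have Nr : 0 < N%:R :> R by rewrite ltr0n.
have ctN' : c%:R * t%:R <= N%:R :> R by rewrite -natrM ler_nat.
have Nct' : N%:R <= (c%:R + 1) * t%:R :> R by rewrite natr1 -natrM ler_nat.
have LtN' : L%:R * t%:R <= N%:R :> R by rewrite -natrM ler_nat.
have tr : 0 <= t%:R :> R by [].
rewrite !natrM in h1 h2; rewrite -natr1 in h2.
(* Moving from [N] to a neighbouring multiple of [t] costs at most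
   [t * (mu + eps) <= eps * L * t <= eps * N], which is the second [eps] of the bound. *)
have k1 : t%:R * (mu + eps) <= t%:R * (eps * L%:R) by rewrite ler_wpM2l.
have k2 : eps * (L%:R * t%:R) <= eps * N%:R by rewrite ler_wpM2l// ltW.
have k3 : (mu + eps) * (c%:R * t%:R) <= (mu + eps) * N%:R.
  by rewrite ler_wpM2l// addr_ge0// ltW.
have k4 : mu * N%:R <= mu * ((c%:R + 1) * t%:R) by rewrite ler_wpM2l.
have k5 : eps * (c%:R * t%:R) <= eps * N%:R by rewrite ler_wpM2l// ltW.
have k6 : 0 <= eps * t%:R by rewrite mulr_ge0// ltW.
set SN := \sum_(i < N) x i in s1 s2 *.
have -> : N%:R^-1 * SN - mu = N%:R^-1 * (SN - N%:R * mu).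
  by rewrite mulrBr mulKf// gt_eqF.
rewrite normrM gtr0_norm ?invr_gt0// ler_pdivrMl// ler_norml.
apply/andP; split; nra.
Qed.

Definition cutoff (c y : R) : R := y * \1_`[0, c] y.

Lemma measurable_cutoff c : measurable_fun setT (cutoff c).
Proof. by apply: measurable_funM => //; exact: measurable_indic. Qed.

Lemma cutoff_id c y : 0 <= y <= c -> cutoff c y = y.
Proof. by move=> yc; rewrite /cutoff indicE mem_set ?mulr1//= in_itv. Qed.

Lemma cutoff_out c y : c < y -> cutoff c y = 0.
Proof.
move=> cy; rewrite /cutoff indicE memNset ?mulr0//= in_itv /=.
by move=> /andP[_]; rewrite leNgt cy.
Qed.

Lemma cutoff_bounds c y : 0 <= c -> 0 <= cutoff c y <= c.
Proof.
move=> c0; have [yc|/negP yc] := boolP (0 <= y <= c); first by rewrite cutoff_id.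
by rewrite /cutoff indicE memNset ?mulr0 ?lexx//= in_itv.
Qed.

Lemma cutoff_le c y : 0 <= y -> cutoff c y <= y.
Proof.
move=> y0; have [yc|/cutoff_out ->//] := leP y c.
by rewrite cutoff_id// y0.
Qed.

(** A geometric sum of ratio 2 is at most twice its last term, and every term kept lies below [v].
    Integrated, this controls the probabilities that a sample exceeds its truncation level. *)
Lemma sum_dyadic_below (c v : R) A : 0 < c -> 0 <= v ->
  \sum_(j < A) c * 2 ^+ j * (c * 2 ^+ j < v)%R%:R <= 2 * v.
Proof.
move=> c0 v0.
(* The second bound closes the induction: when the new term [c * 2 ^+ A] is below [v], the sum
   before it is no larger than that term. *)
suff : (\sum_(j < A) c * 2 ^+ j * (c * 2 ^+ j < v)%R%:R <= 2 * v) /\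
   \sum_(j < A) c * 2 ^+ j * (c * 2 ^+ j < v)%R%:R <= c * 2 ^+ A by case.
elim: A => [|A [IH1 IH2]].
  by rewrite big_ord0; split; rewrite ?mulr_ge0// ?expr0 ?ltW.
rewrite big_ord_recr /=; have [cv|vc] := ltP; rewrite ?mulr1 ?mulr0 ?addr0.
  by split; rewrite ?exprS; lra.
split => //; rewrite (le_trans IH2)// ler_pM2l// ler_eXn2l ?ltr1n//.
Qed.

(** The terms vanish until the level reaches [v]; from there they decay geometrically with ratio
    1/2, starting from at most [v]. Integrated, this controls the truncated second moments. *)
Lemma sum_dyadic_above (c v : R) A : 0 < c -> 0 <= v ->
  \sum_(j < A) (c * 2 ^+ j)^-1 * cutoff (c * 2 ^+ j) v ^+ 2 <= 2 * v.
Proof.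
move=> c0 v0.
set S := fun A => \sum_(j < A) (c * 2 ^+ j)^-1 * cutoff (c * 2 ^+ j) v ^+ 2.
have cA B : 0 < c * 2 ^+ B by rewrite mulr_gt0// exprn_gt0.
(* The added quantity in [H1] is the whole remaining tail of the geometric series, which makes the
   bound stable under induction. *)
suff [H1 H2] : (v <= c * 2 ^+ A -> S A + 2 * ((c * 2 ^+ A)^-1 * v ^+ 2) <= 2 * v) /\
    (c * 2 ^+ A < v -> S A = 0).
  have [vc|cv] := leP v (c * 2 ^+ A); last by rewrite -/(S A) H2// mulr_ge0.
  apply: le_trans (H1 vc); rewrite lerDl.
  by rewrite !mulr_ge0// ?invr_ge0 ?sqr_ge0// ltW.
have key B : v <= c * 2 ^+ B -> (c * 2 ^+ B)^-1 * v ^+ 2 <= v.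
  by move=> vB; rewrite ler_pdivrMl// expr2 ler_wpM2r.
elim: A => [|A [IH1 IH2]].
  rewrite /S big_ord0 add0r; split => // vc.
  by rewrite ler_pM2l//; exact: key.
have -> : S A.+1 = S A + (c * 2 ^+ A)^-1 * cutoff (c * 2 ^+ A) v ^+ 2.
  by rewrite /S big_ord_recr.
have half : (c * 2 ^+ A.+1)^-1 = (c * 2 ^+ A)^-1 / 2.
  by rewrite exprS mulrCA invfM mulrC.
split=> [vc|cv].
  have [vA|Av] := leP v (c * 2 ^+ A).
    by rewrite cutoff_id ?v0// half; have := IH1 vA; lra.
  by rewrite IH2// cutoff_out// expr0n /= mulr0 !add0r ler_pM2l//; exact: key.
have Av : c * 2 ^+ A < v.
  by apply: le_lt_trans cv; rewrite ler_pM2l// ler_eXn2l ?ltr1n//.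
by rewrite IH2// cutoff_out// expr0n /= mulr0 addr0.
Qed.

End strong_law.

(** * A strong law uniform over sequences with a common law *)

Section uniform_strong_law.
Context {d : measure_display} {T : measurableType d} {R : realType}.
Variables (P : probability T R) (V : T -> R).
Hypotheses (mV : measurable_fun setT V) (V0 : forall w, 0 <= V w).
Hypothesis iV : P.-integrable setT (EFin \o V).

Let mu := fine (\int[P]_w (V w)%:E).

Let EVfin : (\int[P]_w (V w)%:E)%E = mu%:E.
Proof. by rewrite fineK//; exact: integrable_fin_num. Qed.

Let mcutoffV c : measurable_fun setT (fun w => cutoff c (V w)).
Proof. exact: measurableT_comp (measurable_cutoff _) mV. Qed.

Definition truncated_mean (c : R) : R := fine (\int[P]_w (cutoff c (V w))%:E).

Lemma truncated_mean_cvg : truncated_mean m%:R @[m --> \oo] --> mu.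
Proof.
apply: fine_cvg; rewrite -EVfin.
have [] // := @dominated_convergence _ _ _ P setT measurableT
  (fun m w => (cutoff m%:R (V w))%:E) (EFin \o V) (EFin \o V).
- by move=> m; apply/measurable_EFinP; exact: mcutoffV.
- exact/measurable_EFinP.
- apply/aeW => w _; apply: cvg_near_cst.
  exists (Num.truncn (V w)).+1 => // m /= Vm; congr EFin.
  apply/eqP; rewrite cutoff_id// V0/= ltW//.
  by rewrite (lt_le_trans (Num.Theory.truncnS_gt _))// ler_nat.
- apply/aeW => w m _ /=; rewrite lee_fin ger0_norm ?cutoff_le//.
  by case/andP: (cutoff_bounds (V w) (ler0n R m)).
Qed.

(* Bound on the probability that [m] samples deviate by [e] on average: some
   sample exceeds [m], or the samples truncated at [m] deviate (Chebyshev). *)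
Definition deviation_bound (e : R) (m : nat) : \bar R :=
  (m%:R%:E * P [set w | (m%:R < V w)%R]
   + (m%:R * (e / 2) ^+ 2)^-1%:E * \int[P]_w (cutoff m%:R (V w) ^+ 2)%:E)%E.

Lemma deviation_bound_ge0 e m : (0 <= deviation_bound e m)%E.
Proof.
apply: adde_ge0; apply: mule_ge0 => //.
  by rewrite lee_fin invr_ge0 mulr_ge0 ?sqr_ge0.
by apply: integral_ge0 => w _; rewrite lee_fin sqr_ge0.
Qed.

(** The error [e] is split in two: one half absorbs the bias of the truncated mean, the other is the
    fluctuation left to Chebyshev. Where no sample exceeds [m], truncation does not alter the
    sum. *)
Lemma truncated_deviation (X : nat -> T -> R) e m :
  pairwise_iid P V X -> (forall i w, 0 <= X i w) ->
  0 < e -> (0 < m)%N -> `|truncated_mean m%:R - mu| <= e / 2 ->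
  exists B : set T, [/\ measurable B, (P B <= deviation_bound e m)%E &
    forall w, ~ B w -> `|\sum_(i < m) X i w - m%:R * mu| <= m%:R * e].
Proof.
move=> iidX X0 e0 m0 hm.
have [mX lawX _] := iidX.
have mlarge (Y : T -> R) c : measurable_fun setT Y -> measurable [set w | c < Y w].
  by move=> mY; rewrite -preimage_itvoy; exact: measurable_preimageT.
pose B1 := \big[setU/set0]_(i < m) [set w | m%:R < X i w].
pose S w := \sum_(i < m) cutoff m%:R (X i w).
have mS : measurable_fun setT S.
  apply: measurable_sum => i; exact: measurableT_comp (measurable_cutoff _) (mX _).
pose B2 := [set w | m%:R * (e / 2) <= `|S w - m%:R * truncated_mean m%:R|].
have mB1 : measurable B1 by apply: bigsetU_measurable => i _; exact: mlarge.
have mB2 : measurable B2.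
  rewrite /B2 -preimage_itvcy; apply: measurable_preimageT => //.
  by apply: measurableT_comp => //; exact: measurable_funB.
have iidC : pairwise_iid P (fun w => cutoff m%:R (V w)) (fun i w => cutoff m%:R (X i w)).
  exact: pairwise_iid_comp (measurable_cutoff _) iidX.
exists (B1 `|` B2); split.
- exact: measurableU.
- apply: (le_trans (measureU2 _ _ _)) => //; apply: leeD.
    apply: (@le_trans _ _ (\sum_(i < m) P [set w | (m%:R < X i w)%R])%E).
      by apply: (Boole_inequality P (A := fun i => [set w | m%:R < X i w])) => i _; exact: mlarge.
    rewrite (eq_bigr (fun=> P [set w | (m%:R < V w)%R])); last first.
      by move=> i _; rewrite -!preimage_itvoy; exact: lawX.
    by rewrite sumr_const card_ord mule_natl.
  apply: (pairwise_iid_chebyshev (K := m%:R) _ _ iidC) => //.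
  + by move=> w; case/andP: (cutoff_bounds (V w) (ler0n R m)).
  + by move=> i w; exact: cutoff_bounds.
  + by rewrite divr_gt0.
move=> w /not_orP[B1w /negP]; rewrite -ltNge => B2w.
have XS : \sum_(i < m) X i w = S w.
  apply: eq_bigr => i _; rewrite cutoff_id// X0/= leNgt; apply/negP => mXi.
  by apply: B1w; rewrite /B1 -(bigcup_mkord _ (fun i => [set w | m%:R < X i w])); exists (nat_of_ord i) => //=.
rewrite XS (_ : _ - _ = (S w - m%:R * truncated_mean m%:R)
  + m%:R * (truncated_mean m%:R - mu)); last by ring.
rewrite (le_trans (ler_normD _ _))// normrM (ger0_norm (ler0n _ _)).
have : m%:R * `|truncated_mean m%:R - mu| <= m%:R * (e / 2) by rewrite ler_wpM2l.
by move: B2w; lra.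
Qed.

(** Exchanging sum and integral reduces both parts to the pointwise dyadic sums, each at most
    [2 * V]. A finite first moment of [V] therefore suffices. *)
Lemma deviation_bound_series e c : 0 < e -> (0 < c)%N ->
  (\sum_(0 <= j <oo) deviation_bound e (c * 2 ^ j) < +oo)%E.
Proof.
move=> e0 c0; have cr : 0 < c%:R :> R by rewrite ltr0n.
have E2V : (\int[P]_w (2 * V w)%:E = (2 * mu)%:E)%E.
  under eq_integral do rewrite EFinM.
  have mVE : measurable_fun setT (fun w => (V w)%:E) by exact/measurable_EFinP.
  rewrite ge0_integralZl//= ?EVfin// ?lee_fin//.
  by move=> w _; rewrite lee_fin.
have m2V : measurable_fun setT (fun w => (2 * V w)%:E).
  by apply/measurable_EFinP; exact: measurable_funM.
have mlarge j : measurable [set w | c%:R * 2 ^+ j < V w].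
  by rewrite -preimage_itvoy; exact: measurable_preimageT.
pose f1 j w := (c%:R * 2 ^+ j * (c%:R * 2 ^+ j < V w)%R%:R)%:E : \bar R.
have f1E j : (\int[P]_w f1 j w = (c * 2 ^ j)%:R%:E * P [set w | ((c * 2 ^ j)%:R < V w)%R])%E.
  rewrite natrM natrX -[P _]mul1e.
  have -> : (1 * P [set w | (c%:R * 2 ^+ j < V w)%R] = \int[P]_w (\1_[set w | (c%:R * 2 ^+ j < V w)%R] w)%:E)%E.
    by rewrite mul1e integral_indic// setIT.
  rewrite -ge0_integralZl//=; last first.
    by apply/measurable_EFinP; exact: measurable_indic.
  apply: eq_integral => w _; rewrite /f1 -EFinM indicE.
  by congr (_ * _%:R)%:E; congr nat_of_bool; apply/idP/idP; rewrite inE.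
have mf1 j : measurable_fun setT (f1 j).
  apply/measurable_EFinP; rewrite (_ : (fun _ => _) = (fun w => c%:R * 2 ^+ j * \1_[set w | (c%:R * 2 ^+ j < V w)%R] w)).
    by apply: measurable_funM => //; exact: measurable_indic.
  by apply/funext => w; rewrite indicE; congr (_ * _%:R); congr nat_of_bool; apply/idP/idP; rewrite inE.
have f10 j w : (0 <= f1 j w)%E by rewrite lee_fin !mulr_ge0// exprn_ge0.
pose f2 j w := ((c%:R * 2 ^+ j)^-1 * cutoff (c%:R * 2 ^+ j) (V w) ^+ 2)%:E : \bar R.
have mf2 j : measurable_fun setT (f2 j).
  by apply/measurable_EFinP; apply: measurable_funM => //; exact: measurable_funX.
have f20 j w : (0 <= f2 j w)%E.
  by rewrite lee_fin mulr_ge0 ?sqr_ge0// invr_ge0 mulr_ge0// exprn_ge0.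
have f2E j : (((c * 2 ^ j)%:R * (e / 2) ^+ 2)^-1%:E * \int[P]_w (cutoff (c * 2 ^ j)%:R (V w) ^+ 2)%:E
   = ((e / 2) ^- 2)%:E * \int[P]_w f2 j w)%E.
  rewrite natrM natrX invfM mulrC EFinM -muleA; congr (_ * _)%E.
  rewrite -ge0_integralZl//=.
  - by apply/measurable_EFinP; exact: measurable_funX.
  - by move=> w _; rewrite lee_fin sqr_ge0.
have E1 A : (\sum_(j < A) \int[P]_w f1 j w <= (2 * mu)%:E)%E.
  rewrite -ge0_integral_sum// -E2V; apply: ge0_le_integral => //.
  - by move=> w _; exact: sume_ge0.
  - exact: emeasurable_sum.
  - by move=> w _; rewrite sumEFin lee_fin sum_dyadic_below.
have E2 A : (\sum_(j < A) \int[P]_w f2 j w <= (2 * mu)%:E)%E.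
  rewrite -ge0_integral_sum// -E2V; apply: ge0_le_integral => //.
  - by move=> w _; exact: sume_ge0.
  - exact: emeasurable_sum.
  - by move=> w _; rewrite sumEFin lee_fin sum_dyadic_above.
apply: (@le_lt_trans _ _ ((2 * mu)%:E + ((e / 2) ^- 2)%:E * (2 * mu)%:E)%E); last first.
  by rewrite -EFinM -EFinD ltry.
apply: lime_le; first by apply: is_cvg_nneseries => j _ _; exact: deviation_bound_ge0.
apply: nearW => A; rewrite big_mkord.
under eq_bigr do rewrite /deviation_bound -f1E f2E.
rewrite big_split /=; apply: leeD; first exact: E1.
rewrite -ge0_sume_distrr; last by move=> j _; exact: integral_ge0.
by apply: lee_wpmul2l; [rewrite lee_fin invr_ge0 sqr_ge0|exact: E2].
Qed.

(* [M] depends only on the law of [V], not on the sequence [X]. *)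
Theorem uniform_strong_law (e dl : R) : 0 < e -> 0 < dl ->
  exists M, forall X : nat -> T -> R,
    pairwise_iid P V X -> (forall i w, 0 <= X i w) ->
    exists2 B : set T, measurable B /\ (P B <= dl%:E)%E &
      forall w, ~ B w -> forall N, (M <= N)%N ->
        `|N%:R^-1 * \sum_(i < N) X i w - mu| <= e.
Proof.
move=> e0 dl0; pose eps := e / 2.
have eps0 : 0 < eps by rewrite divr_gt0.
have mu0 : 0 <= mu by rewrite fine_ge0// integral_ge0// => w _; rewrite lee_fin.
(* Large enough for the relative gap [1/L] between consecutive sizes to cost at most [eps], as the
   interpolation demands. *)
pose L := (Num.truncn ((mu + eps) / eps)).+1.
have muL : mu + eps <= eps * L%:R.
  by rewrite -ler_pdivrMl// mulrC ltW// Num.Theory.truncnS_gt.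
have [m0 _ hm0] : \forall m \near \oo, `|truncated_mean m%:R - mu| <= eps / 2.
  have /cvgrPdist_le := truncated_mean_cvg => /(_ (eps / 2)).
  rewrite divr_gt0// => /(_ isT); apply: filterS => m.
  by rewrite distrC.
(* Union bound over all multipliers from [L] to [L.*2] at scale [2 ^ j]; its tail from [A0] on is at
   most [dl]. *)
pose U j := (\sum_(i < L.+1) deviation_bound eps ((L + i) * 2 ^ j))%E.
have U0 j : (0 <= U j)%E by apply: sume_ge0 => c _; exact: deviation_bound_ge0.
have Ufin : (\sum_(0 <= j <oo) U j < +oo)%E.
  rewrite nneseries_sum; last by move=> i j _; exact: deviation_bound_ge0.
  apply: lte_sum_pinfty => i _.
  by apply: deviation_bound_series => //; rewrite addSn.
have [A0 _ hA0] : \forall A \near \oo, (\sum_(A <= j <oo) U j <= dl%:E)%E.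
  have : (\sum_(A <= j <oo) U j @[A --> \oo] --> 0)%E by apply: nneseries_tail_cvg => // j _; exact: U0.
  have dlE : (0 < dl%:E)%E by rewrite lte_fin.
  move=> tail0; have tail_lt := tail0 _ (open_ereal_lt' dlE).
  by apply: (@filterS _ \oo _ _ _ _ tail_lt) => A; rewrite /=; exact: ltW.
(* Including [m0] keeps every size [c * 2 ^ j] with [j >= A] above the threshold where the
   truncation bias is at most [eps / 2]. *)
pose A := maxn A0 m0.
exists (L * 2 ^ A)%N => X iidX X0.
have devB (cj : nat * nat) : exists B : set T, [/\ measurable B,
    (P B <= deviation_bound eps (cj.1 * 2 ^ cj.2))%E &
    (L <= cj.1)%N -> (A <= cj.2)%N ->
    forall w, ~ B w ->
      `|\sum_(i < cj.1 * 2 ^ cj.2) X i w - (cj.1 * 2 ^ cj.2)%:R * mu|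
         <= (cj.1 * 2 ^ cj.2)%:R * eps].
  case: cj => c j /=.
  (* Choice requires a set for every pair; pairs out of range get the empty set. *)
  have [/andP[Lc Aj]|nLA] := boolP ((L <= c)%N && (A <= j)%N); last first.
    exists set0; split => //; first by rewrite measure0 deviation_bound_ge0.
    by move=> Lc Aj; rewrite Lc Aj in nLA.
  have c0 : (0 < c)%N by rewrite (leq_trans _ Lc).
  have m0j : (m0 <= c * 2 ^ j)%N.
    rewrite (leq_trans (ltnW (ltn_expl m0 (isT : (1 < 2)%N))))//.
    rewrite -[(2 ^ m0)%N]mul1n leq_mul// leq_pexp2l// (leq_trans _ Aj)//.
    exact: leq_maxr.
  have cj0 : (0 < c * 2 ^ j)%N by rewrite muln_gt0 c0 expn_gt0.
  have [B [mB PB HB]] := truncated_deviation iidX X0 eps0 cj0 (hm0 _ m0j).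
  by exists B; split.
have [B HB] := choice devB.
pose BB j := \big[setU/set0]_(i < L.+1) B ((L + i)%N, j).
have mBB j : measurable (BB j).
  by apply: bigsetU_measurable => i _; have [] := HB ((L + i)%N, j).
exists (\bigcup_(j in ~` `I_A) BB j).
  have mU : measurable (\bigcup_(j in ~` `I_A) BB j).
    by apply: bigcup_measurable => j _; exact: mBB.
  split => //.
  apply: le_trans (hA0 A (leq_maxl _ _)).
  apply: (le_trans (@measure_sigma_subadditive_tail _ _ _ P _ BB A mBB mU _)) => //.
  apply: lee_nneseries => // j _.
  apply: (@le_trans _ _ (\sum_(i < L.+1) P (B ((L + i)%N, j)))%E).
    apply: (Boole_inequality P (A := fun i => B ((L + i)%N, j))) => i _.
    by have [] := HB ((L + i)%N, j).
  by apply: lee_sum => i _; have [] := HB ((L + i)%N, j).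
move=> w nBw N LN.
have -> : e = 2 * eps by rewrite /eps; lra.
apply: (dyadic_average_interpolation (x := X ^~ w) (L := L) (A := A)) => // c j /andP[Lc cL] Aj.
have [_ _] := HB (c, j); apply => //= Bw.
apply: nBw; exists j; first by apply/negP; rewrite -leqNgt.
rewrite /BB -(bigcup_mkord _ (fun i => B ((L + i)%N, j))).
exists (c - L)%N; last by rewrite subnKC.
by rewrite /= ltnS leq_subLR addnn.
Qed.

End uniform_strong_law.

(** * Good iterations occurring infinitely often *)

Section infinitely_often.
Context {d : measure_display} {T : measurableType d} {R : realType}.
Variable P : probability T R.

(** The points lying in [B j k] for all large [k] form the increasing union of the sets [F j K],
    each inside [B j K]; by continuity from below this union has probability at most [1/(j+1)],
    whatever the dependence between different [k]. The intersection over [j] is thus null. *)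
Lemma ae_frequently (A : nat -> nat -> set T) (B : nat -> nat -> set T) :
  (forall j k, measurable (B j k)) ->
  (forall j k, (P (B j k) <= j.+1%:R^-1%:E)%E) ->
  (forall j k, ~` B j k `<=` A j k) ->
  {ae P, forall w, exists j, forall K, exists2 k, (K <= k)%N & A j k w}.
Proof.
move=> mB PB BA.
pose F j K := \bigcap_(k in [set k | (K <= k)%N]) B j k.
have mF j K : measurable (F j K) by exact: bigcap_measurableType.
have mC j : measurable (\bigcup_K F j K) by exact: bigcup_measurable.
have PC j : (P (\bigcup_K F j K) <= j.+1%:R^-1%:E)%E.
  have ndF : nondecreasing_seq (F j).
    move=> K K' KK'; apply/subsetPset => w Fw k /= K'k.
    by apply: Fw; rewrite /= (leq_trans KK').
  apply: (cvge_to_le (nondecreasing_cvg_mu (mF j) (mC j) ndF)).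
  apply: nearW => K /=; apply: le_trans (PB j K).
  by apply: le_measure; rewrite ?inE// => w Fw; exact: (Fw K (leqnn K)).
exists (\bigcap_j \bigcup_K F j K); split.
- exact: bigcap_measurableType.
- apply/eqP; rewrite eq_le measure_ge0 andbT; apply/lee_addgt0Pr => e e0.
  rewrite add0e; have [j je] : exists j, j.+1%:R^-1 <= e.
    exists (Num.truncn e^-1); rewrite invf_ple ?posrE//.
    by rewrite ltW// Num.Theory.truncnS_gt.
  apply: (@le_trans _ _ (P (\bigcup_K F j K))).
    apply: le_measure; rewrite ?inE//; first exact: bigcap_measurableType.
    by move=> w Cw; exact: (Cw j).
  by rewrite (le_trans (PC j))// lee_fin.
move=> w /= nw j _; apply: contrapT => nC; apply: nw; exists j => K.
apply: contrapT => nk; apply: nC; exists K => // k /= Kk.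
by apply: contrapT => /BA Ajk; apply: nk; exists k.
Qed.

(** The threshold of the uniform law depends only on the common law and on [j], so [M] can be fixed
    before [k]: random sample sizes beyond [M] are then all covered at once. *)
Lemma ae_frequently_close (V W : T -> R) (X Y : nat -> nat -> T -> R) (e : R) :
  measurable_fun setT V -> (forall w, 0 <= V w) -> P.-integrable setT (EFin \o V) ->
  measurable_fun setT W -> (forall w, 0 <= W w) -> P.-integrable setT (EFin \o W) ->
  (forall k, pairwise_iid P V (X k)) -> (forall k i w, 0 <= X k i w) ->
  (forall k, pairwise_iid P W (Y k)) -> (forall k i w, 0 <= Y k i w) ->
  0 < e ->
  {ae P, forall w, exists M, forall K, exists2 k, (K <= k)%N &
    forall N, (M <= N)%N ->
      `|N%:R^-1 * \sum_(i < N) X k i w - fine (\int[P]_w (V w)%:E)| <= e /\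
      `|N%:R^-1 * \sum_(i < N) Y k i w - fine (\int[P]_w (W w)%:E)| <= e}.
Proof.
move=> mV V0 iV mW W0 iW iidX X0 iidY Y0 e0.
(* Half of [1/(j+1)] for each of the two test functions, so that the union of their exceptional sets
   meets the bound of [ae_frequently]. *)
have hdl (j : nat) : 0 < j.+1%:R^-1 / 2 :> R by rewrite divr_gt0 ?invr_gt0.
have hM j := uniform_strong_law mV V0 iV e0 (hdl j).
have hM' j := uniform_strong_law mW W0 iW e0 (hdl j).
have [M HM] := choice hM; have [M' HM'] := choice hM'.
pose A j k := [set w | forall N, (maxn (M j) (M' j) <= N)%N ->
  `|N%:R^-1 * \sum_(i < N) X k i w - fine (\int[P]_w (V w)%:E)| <= e /\
  `|N%:R^-1 * \sum_(i < N) Y k i w - fine (\int[P]_w (W w)%:E)| <= e].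
have hB (jk : nat * nat) : exists B : set T, [/\ measurable B,
    (P B <= jk.1.+1%:R^-1%:E)%E & ~` B `<=` A jk.1 jk.2].
  case: jk => j k /=.
  have [B [mB PB] HB] := HM j _ (iidX k) (X0 k).
  have [B' [mB' PB'] HB'] := HM' j _ (iidY k) (Y0 k).
  exists (B `|` B'); split.
  - exact: measurableU.
  - rewrite (le_trans (measureU2 _ mB mB'))// (le_trans (leeD PB PB'))//.
    by rewrite -EFinD lee_fin -splitr.
  - by move=> w /not_orP[Bw Bw'] N; rewrite geq_max => /andP[MN MN']; split; auto.
have [B HB] := choice hB.
have := @ae_frequently A (fun j k => B (j, k)).
move=> /(_ (fun j k => let: And3 h _ _ := HB (j, k) in h)
  (fun j k => let: And3 _ h _ := HB (j, k) in h)
  (fun j k => let: And3 _ _ h := HB (j, k) in h)).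
apply: filterS => w [j Hj]; exists (maxn (M j) (M' j)) => K.
by have [k Kk Ak] := Hj K; exists k.
Qed.

End infinitely_often.

Lemma iid_sample_pairwise {d : measure_display} {T : measurableType d}
    {R : realType} {q : nat} (P : probability T R) (xi : T -> 'rV[R]_q)
    (Y : nat -> T -> 'rV[R]_q) :
  iid_sample P xi Y ->
  pairwise_iid P (xi : T -> borel R q) (fun i => (Y i : T -> borel R q)).
Proof.
move=> [mY lawY indY]; split => // i j A B ij mA mB.
pose S k := if k == i then A else B.
have mS k : measurable (S k) by rewrite /S; case: ifP.
have Si : S i = A by rewrite /S eqxx.
have Sj : S j = B by rewrite /S eq_sym (negbTE ij).
have := indY [fset i; j]%fset S mS.
rewrite big_fsetU1 ?inE//= big_seq_fset1 Si Sj => <-; congr (P _).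
apply/seteqP; split => [w [Aw Bw] k /=|w /= Hw].
  by rewrite !inE => /orP[] /eqP ->; rewrite ?Si ?Sj.
by split; [have := Hw i|have := Hw j]; rewrite /= !inE eqxx ?orbT ?Si ?Sj; apply.
Qed.

(** * A dense sequence of rational points *)

Section rational_points.
Context {R : realType} {n : nat}.
Implicit Types (u v x : 'rV[R]_n).

(** Codes that decode to no rational vector give 0. Indexing by [nat] lets almost sure statements
    hold at all rational points simultaneously. *)
Definition rational_point (i : nat) : 'rV[R]_n :=
  if choice.unpickle i is Some v then map_mx ratr (v : 'rV[rat]_n) else 0.

Lemma rational_point_dense x (e : R) : 0 < e -> exists i, ball x e (rational_point i).
Proof.
move=> e0.
have rat_near (j : 'I_n) : exists r : rat, `|x ord0 j - ratr r| < e.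
  have /rat_in_itvoo[r] : x ord0 j - e < x ord0 j + e by lra.
  rewrite in_itv /= => /andP[xr rx]; exists r.
  by rewrite ltr_norml; apply/andP; split; lra.
have [r rx] := choice rat_near.
exists (choice.pickle (\row_j r j)); rewrite /rational_point choice.pickleK; split => // i j.
by rewrite !mxE ord1; exact: rx.
Qed.

End rational_points.

(** * Truncated infima of the integrand over small balls *)

Section local_infimum.
Context {R : realType} {n q : nat}.
Variables (F : 'rV[R]_n -> 'rV[R]_q -> R) (C : R).
Hypothesis mF : forall x, measurable_fun setT (F x : borel R q -> R).
Hypothesis cF : forall z, continuous (F ^~ z).
Hypothesis CF : forall x z, C <= F x z.

(* A dense sequence in the ball of radius [1/(m+1)] around the [i]-th rational
   point. *)
Definition cell_point (i m l : nat) : 'rV[R]_n :=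
  if `[< ball (rational_point i) m.+1%:R^-1 (rational_point l : 'rV[R]_n) >]
  then rational_point l else rational_point i.

(** The countable infimum keeps measurability, the shift by [C] gives nonnegativity, and the cap [m]
    gives integrability. The radius and the cap share the index [m], so one limit shrinks the ball
    and removes the cap. *)
Definition cell_inf (i m : nat) (z : 'rV[R]_q) : R :=
  infs (fun l => Num.min (F (cell_point i m l) z - C) m%:R) 0%N.

Lemma cell_point_ball i m l :
  ball (rational_point i) m.+1%:R^-1 (cell_point i m l).
Proof.
rewrite /cell_point; case: asboolP => // _; apply: ballxx.
by rewrite invr_gt0.
Qed.

Let lower_bound i m z :
  lbound (sdrop (fun l => Num.min (F (cell_point i m l) z - C) m%:R) 0%N) 0.
Proof. by move=> _ [l _ <-]; rewrite le_min ler0n andbT subr_ge0. Qed.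

Lemma cell_inf_ge0 i m z : 0 <= cell_inf i m z.
Proof.
apply: lb_le_inf; last exact: lower_bound.
by exists (Num.min (F (cell_point i m 0) z - C) m%:R), 0%N.
Qed.

Lemma cell_inf_le_point i m z l : cell_inf i m z <= F (cell_point i m l) z - C.
Proof.
apply: (@le_trans _ _ (Num.min (F (cell_point i m l) z - C) m%:R)).
  by apply: ge_inf; [exists 0; exact: lower_bound|exists l].
by rewrite ge_min lexx.
Qed.

Lemma cell_inf_le_bound i m z : cell_inf i m z <= m%:R.
Proof.
apply: (@le_trans _ _ (Num.min (F (cell_point i m 0) z - C) m%:R)).
  by apply: ge_inf; [exists 0; exact: lower_bound|exists 0%N].
by rewrite ge_min lexx orbT.
Qed.

Lemma measurable_cell_inf i m :
  measurable_fun setT (cell_inf i m : borel R q -> R).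
Proof.
apply: (@measurable_fun_infs _ (borel R q) R setT
  (fun l z => Num.min (F (cell_point i m l) z - C) m%:R) 0%N).
  by move=> z _; exists 0 => _ [l _ <-]; apply: (@lower_bound i m z); exists l.
move=> l; apply: measurable_minr => //.
by apply: measurable_funB => //; exact: mF.
Qed.

Lemma integrable_cell_inf {d : measure_display} {T : measurableType d}
    (P : probability T R) (xi : T -> 'rV[R]_q) i m :
  random_vector xi -> P.-integrable setT (EFin \o (cell_inf i m \o xi)).
Proof.
move=> mxi; apply: measurable_bounded_integrable => //.
- by rewrite -ge0_fin_numE ?fin_num_measure.
- exact: (measurableT_comp (measurable_cell_inf i m) mxi).
- exists m%:R; split; first exact: num_real.
  move=> b mb w _ /=; rewrite ger0_norm ?cell_inf_ge0//.
  by rewrite (le_trans (cell_inf_le_bound _ _ _))// ltW.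
Qed.

(** Rational points inside the open ball come arbitrarily close to [x], and continuity of [F ^~ z]
    carries their bound over to [x]. *)
Lemma cell_inf_le i m x z : ball (rational_point i) m.+1%:R^-1 x ->
  cell_inf i m z <= F x z - C.
Proof.
move=> ix; apply/ler_addgt0Pr => e e0.
have [r /= r0 Hr] : nbhs_ball x [set u | `|F x z - F u z| < e].
  by apply/nbhs_ballP; have /cvgrPdist_lt := @cF z x; exact.
have /nbhs_ballP[r' /= r'0 Hr'] : nbhs x (ball (rational_point i) m.+1%:R^-1).
  exact: open_nbhs_nbhs (conj (ball_open _ _) ix).
have [|l Hl] := @rational_point_dense R n x (Num.min r r').
  by rewrite lt_min r0.
have lr : ball x r (rational_point l) by apply: le_ball Hl; rewrite ge_min lexx.
have lr' : ball x r' (rational_point l).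
  by apply: le_ball Hl; rewrite ge_min lexx orbT.
apply: le_trans (cell_inf_le_point i m z l) _.
rewrite /cell_point asboolT; last exact: Hr'.
by have := Hr _ lr; rewrite /= ltr_norml => /andP[h _]; lra.
Qed.

(** The ball around the rational point lies within distance [2/(m+1)] of [x], where [F ^~ z]
    eventually varies by less than [e]; the cap is harmless once [m] exceeds [F x z - C]. *)
Lemma cell_inf_lim x (i : nat -> nat) z :
  (forall m, ball x m.+1%:R^-1 (rational_point (i m) : 'rV[R]_n)) ->
  forall e, 0 < e -> \forall m \near \oo, F x z - C - e <= cell_inf (i m) m z.
Proof.
move=> ix e e0.
have [r /= r0 Hr] : nbhs_ball x [set u | `|F x z - F u z| < e].
  by apply/nbhs_ballP; have /cvgrPdist_lt := @cF z x; exact.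
exists (maxn (Num.truncn (2 / r)).+1 (Num.truncn (F x z - C)).+1) => // m /=.
rewrite geq_max => /andP[m1 m2].
have mr : m.+1%:R^-1 + m.+1%:R^-1 <= r.
  have : 2 / r <= m.+1%:R.
    rewrite ltW// (lt_le_trans (Num.Theory.truncnS_gt _))// ler_nat.
    by rewrite (leq_trans m1).
  rewrite ler_pdivrMr// => h.
  have m0 : 0 < m.+1%:R :> R by [].
  rewrite -(ler_pM2r m0) mulrDl mulVf ?gt_eqF// mulrC.
  by move: h; lra.
have mb : F x z - C <= m%:R.
  by rewrite ltW// (lt_le_trans (Num.Theory.truncnS_gt _))// ler_nat.
apply: lb_le_inf.
  by exists (Num.min (F (cell_point (i m) m 0) z - C) m%:R), 0%N.
move=> _ [l _ <-]; rewrite le_min; apply/andP; split; last by lra.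
have : ball x r (cell_point (i m) m l).
  by apply: le_ball mr _ _; exact: ball_triangle (ix m) (cell_point_ball _ _ _).
by move=> /Hr /=; rewrite ltr_norml => /andP[_ h]; lra.
Qed.

(** If cells shrinking to [x] all had expectation at most [a], Fatou would bound the expectation at
    [x] by [a]. Fatou also covers an infinite expectation at [x]. *)
Lemma cell_inf_expectation {d : measure_display} {T : measurableType d}
    (P : probability T R) (xi : T -> 'rV[R]_q) (x : 'rV[R]_n) (a : R) :
  random_vector xi ->
  (a%:E < \int[P]_w (F x (xi w) - C)%:E)%E ->
  exists i m, ball (rational_point i) m.+1%:R^-1 x /\
    (a%:E < \int[P]_w (cell_inf i m (xi w))%:E)%E.
Proof.
move=> mxi aE.
have hi (m : nat) : exists i, ball x m.+1%:R^-1 (rational_point i : 'rV[R]_n).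
  by apply: rational_point_dense; rewrite invr_gt0.
have [i Hi] := choice hi.
apply: contrapT => nE.
have le_a m : (\int[P]_w (cell_inf (i m) m (xi w))%:E <= a%:E)%E.
  rewrite leNgt; apply/negP => lt_a; apply: nE; exists (i m), m; split => //.
  exact/ball_sym.
have mphi m : measurable_fun setT (fun w => (cell_inf (i m) m (xi w))%:E).
  apply/measurable_EFinP.
  exact: (measurableT_comp (measurable_cell_inf (i m) m) mxi).
have := @fatou _ _ _ P setT measurableT
  (fun m w => (cell_inf (i m) m (xi w))%:E) mphi.
have phi0 m w : setT w -> (0 <= (cell_inf (i m) m (xi w))%:E)%E.
  by move=> _; rewrite lee_fin cell_inf_ge0.
move=> /(_ phi0); apply/negP; rewrite -ltNge.
apply: le_lt_trans (lt_le_trans aE _).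
  rewrite limn_einf_lim; apply: lime_le; first exact: is_cvg_einfs.
  apply: nearW => m; apply: le_trans (le_a m).
  by apply: ereal_inf_lbound; exists m => /=.
apply: ge0_le_integral => //.
- by move=> w _; rewrite lee_fin subr_ge0.
- apply/measurable_EFinP; apply: measurable_funB => //.
  exact: (measurableT_comp (mF x) mxi).
(* The lower limit is treated as minus the upper limit of the negated sequence. *)
- apply: measurableT_comp => //.
  apply: (measurable_fun_limn_esup
    (f := fun m w => (- (cell_inf (i m) m (xi w))%:E)%E)) => m.
  exact: measurableT_comp.
- move=> w _; apply/lee_subgt0Pr => e e0.
  rewrite limn_einf_lim; apply: lime_ge; first exact: is_cvg_einfs.
  have [m0 _ Hm] := cell_inf_lim (xi w) Hi e0.
  exists m0 => // m /= m0m; apply: le_ereal_inf_tmp => _ [k /= mk <-].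
  by rewrite -EFinB lee_fin Hm//= (leq_trans m0m).
Qed.

End local_infimum.

(** * Integrability and approximation of the objective *)

Section objective.
Context {R : realType} {n q : nat} {d : measure_display} {T : measurableType d}.
Variables (P : probability T R) (xi : T -> 'rV[R]_q).
Variables (F : 'rV[R]_n -> 'rV[R]_q -> R) (C : R).
Hypothesis mxi : random_vector xi.
Hypothesis mF : forall x, measurable_fun setT (F x : borel R q -> R).
Hypothesis CF : forall x z, C <= F x z.

Lemma measurable_objective x : measurable_fun setT (fun w => F x (xi w)).
Proof. exact: (measurableT_comp (mF x) mxi). Qed.

Lemma excess_expectation x :
  P.-integrable setT (fun w => (F x (xi w))%:E) ->
  (\int[P]_w (F x (xi w) - C)%:E = objective F P xi x - C%:E)%E.
Proof.
move=> iF; rewrite /objective unlock.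
under eq_integral do rewrite EFinB.
rewrite integralB//; last exact: finite_measure_integrable_cst.
by rewrite integral_cst// [X in (_ * X)%E]probability_setT mule1.
Qed.

Lemma integrable_of_excess x :
  (\int[P]_w (F x (xi w) - C)%:E < +oo)%E ->
  P.-integrable setT (fun w => (F x (xi w))%:E).
Proof.
move=> Efin.
have iV : P.-integrable setT (fun w => (F x (xi w) - C)%:E).
  apply/integrableP; split.
    by apply/measurable_EFinP; apply: measurable_funB => //; exact: measurable_objective.
  apply: le_lt_trans Efin; apply: ge0_le_integral => //.
  - apply/measurable_EFinP; apply: measurableT_comp => //.
    by apply: measurable_funB => //; exact: measurable_objective.
  - by apply/measurable_EFinP; apply: measurable_funB => //; exact: measurable_objective.
  - by move=> w _; rewrite /= ger0_norm// subr_ge0.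
have iC : P.-integrable setT (cst C%:E) by exact: finite_measure_integrable_cst.
have := integrableD measurableT iV iC; apply: eq_integrable => // w _.
by rewrite /= -EFinD subrK.
Qed.

(** The objective may be infinite, so the constant cannot be subtracted directly. A failure of the
    conclusion would make [F x] integrable, and then the subtraction is legitimate. *)
Lemma excess_expectation_gt x b :
  (b%:E < objective F P xi x)%E ->
  ((b - C)%:E < \int[P]_w (F x (xi w) - C)%:E)%E.
Proof.
move=> bf; rewrite ltNge; apply/negP => Eb.
have iF : P.-integrable setT (fun w => (F x (xi w))%:E).
  by apply: integrable_of_excess; rewrite (le_lt_trans Eb)// ltry.
move: Eb; rewrite excess_expectation// EFinB leeD2rE//.
by rewrite leNgt bf.
Qed.

(** Domination on the open set [D0] makes the objective converge along rational points of [D0]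
    tending to [y]. *)
Lemma rational_point_below (D0 : set 'rV[R]_n) (G : 'rV[R]_q -> R) y c :
  (forall z, continuous (F ^~ z)) ->
  open D0 -> D0 y ->
  P.-integrable setT (fun w => (G (xi w))%:E) ->
  {ae P, forall w, forall x, D0 x -> `|F x (xi w)| <= G (xi w)} ->
  (objective F P xi y < c)%E ->
  exists l : nat,
    P.-integrable setT (fun w => (F (rational_point l) (xi w))%:E) /\
    (objective F P xi (rational_point l) < c)%E.
Proof.
move=> cF oD0 D0y iG FG yc.
have /nbhs_ballP[r /= r0 rD0] : nbhs y D0 by exact: open_nbhs_nbhs.
have hl (m : nat) : exists l, ball y (Num.min r m.+1%:R^-1) (rational_point l : 'rV[R]_n).
  by apply: rational_point_dense; rewrite lt_min r0 invr_gt0/=.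
have [l Hl] := choice hl.
have D0l m : D0 (rational_point (l m)).
  by apply: rD0; apply: le_ball (Hl m); rewrite ge_min lexx.
have ly : rational_point (l m) @[m --> \oo] --> y.
  apply/cvg_ballP => e e0.
  exists (Num.truncn e^-1) => // m /= em.
  apply: le_ball (Hl m); rewrite ge_min; apply/orP; right.
  rewrite invf_ple ?posrE// ltW// (lt_le_trans (Num.Theory.truncnS_gt _))//.
  by rewrite ler_nat.
pose f m w := (F (rational_point (l m)) (xi w))%:E.
have mf u : measurable_fun setT (fun w => (F u (xi w))%:E).
  by apply/measurable_EFinP; exact: measurable_objective.
have dominated : {ae P, forall w m, setT w -> (`|f m w| <= (G (xi w))%:E)%E}.
  by apply: filterS FG => w Hw m _; rewrite lee_fin; exact: Hw.
have ptw : {ae P, forall w, setT w -> f m w @[m --> \oo] --> (F y (xi w))%:E}.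
  apply: aeW => w _; apply: cvg_EFin; first exact: nearW.
  exact: (cvg_comp _ _ ly (cF (xi w) y)).
have [_ _ cvgf] := dominated_convergence measurableT (fun m => mf _) (mf y) ptw iG dominated.
have yc' : (\int[P]_w (F y (xi w))%:E < c)%E by move: yc; rewrite /objective unlock.
have [m0 _ Hm0] := cvgf _ (open_ereal_lt' yc').
exists (l m0); split; last by rewrite /objective unlock; exact: (Hm0 m0 (leqnn m0)).
(* Dominated convergence for a constant sequence yields the integrability of its limit [f m0]. *)
have cst_cvg : {ae P, forall w, setT w -> f m0 w @[_ --> \oo] --> f m0 w}.
  apply: aeW => w _. exact: cvg_cst.
have cst_dom : {ae P, forall w (m : nat), setT w -> (`|f m0 w| <= (G (xi w))%:E)%E}.
  by apply: filterS dominated => w Hw m; exact: Hw.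
by have [] := dominated_convergence measurableT (fun=> mf _) (mf _) cst_cvg iG cst_dom.
Qed.

End objective.

(** * Euclidean estimates and strictly strong accumulation points *)

Section euclidean.
Context {R : realType} {n : nat}.
Implicit Types u v p g : 'rV[R]_n.

Lemma dot_ge0 u : 0 <= dot u u.
Proof. by apply: sumr_ge0 => i _; rewrite -expr2 sqr_ge0. Qed.

Lemma sqr_norm2 u : norm2 u ^+ 2 = dot u u.
Proof. by rewrite /norm2 sqr_sqrtr// dot_ge0. Qed.

(** Young's inequality with weight [t], by completing a square in each coordinate. *)
Lemma dot_ge u v (t : R) : 0 < t -> - (t * dot u u + t^-1 * dot v v) <= 2 * dot u v.
Proof.
move=> t0; rewrite -subr_ge0 opprK /dot !mulr_sumr -!big_split /=.
apply: sumr_ge0 => i _; set a := u ord0 i; set b := v ord0 i.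
have -> : 2 * (a * b) + (t * (a * a) + t^-1 * (b * b)) = t * (a + b / t) ^+ 2.
  by field; rewrite gt_eqF.
by rewrite mulr_ge0 ?sqr_ge0// ltW.
Qed.

Lemma mx_norm_lt_dot u (e : R) : 0 < e -> dot u u < e ^+ 2 -> `|u| < e.
Proof.
move=> e0 ue.
suff : ball 0 e u by rewrite -ball_normE /= sub0r normrN.
split => // i j; rewrite ord1 mxE -ball_normE /= sub0r normrN.
rewrite -(ltr_pXn2r (ltn0Sn 1)) ?nnegrE ?normr_ge0 ?(ltW e0)// real_normK ?num_real//.
apply: le_lt_trans ue; rewrite /dot (bigD1 j)//= -expr2 lerDl.
by apply: sumr_ge0 => k _; rewrite -expr2 sqr_ge0.
Qed.

(** The subgradient defining [p] is itself one of those in the supremum, so its product with [p] is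
    at most [- (mB / 2) * dot g g]; Young with weight [mB / 2] turns this into control of [g] by
    [p]. *)
Lemma descent_direction_subgradient (mB : R) phi x B p :
  0 < mB -> descent_direction mB phi x B p ->
  exists2 g, subdiff phi x g & dot g g <= 4 / mB ^+ 2 * dot p p.
Proof.
move=> m0 [g gx [_ gp]]; exists g => //.
have {}gp : dot g p <= - (mB / 2) * dot g g.
  rewrite -sqr_norm2 -lee_fin; apply: le_trans gp.
  by apply: ereal_sup_ubound; exists g.
have m2 : 0 < mB / 2 by rewrite divr_gt0.
have := dot_ge g p m2; rewrite invf_div => dge.
rewrite -(ler_pM2l m2).
have -> : mB / 2 * (4 / mB ^+ 2 * dot p p) = 2 / mB * dot p p.
  by field; rewrite gt_eqF.
lra.
Qed.

(** Every late index lies between two consecutive selected ones, hence at most [b] vanishing steps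
    after a point near [xs]. *)
Lemma strictly_strong_cvg (x : nat -> 'rV[R]_n) xs :
  (x k.+1 - x k) @[k --> \oo] --> (0 : 'rV[R]_n) ->
  strictly_strong_accumulation_point x xs ->
  x k @[k --> \oo] --> xs.
Proof.
move=> dx [k [b [kS kxs kb]]].
apply/cvgrPdist_lt => e e0.
(* Half of [e] is shared among at most [b] steps; [b.+1] keeps the divisor positive. *)
have e'0 : 0 < e / 2 / b.+1%:R by rewrite !divr_gt0.
have e20 : 0 < e / 2 by rewrite divr_gt0.
have /cvgrPdist_lt/(_ _ e'0)[K _ HK] := dx.
have /cvgrPdist_lt/(_ _ e20)[I _ HI] := kxs.
have step j l : (K <= j)%N -> `|x (j + l)%N - x j| <= l%:R * (e / 2 / b.+1%:R).
  move=> Kj; elim: l => [|l IH]; first by rewrite addn0 subrr normr0 mul0r.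
  have -> : x (j + l.+1)%N - x j = (x (j + l).+1 - x (j + l)%N) + (x (j + l)%N - x j).
    by rewrite addnS addrA subrK.
  rewrite (le_trans (ler_normD _ _))// -natr1 mulrDl mul1r addrC lerD// ltW//.
  have := HK (j + l)%N (leq_trans Kj (leq_addr _ _)).
  by rewrite /= sub0r normrN.
have kge i : (i <= k i)%N.
  by elim: i => // i IH; apply: leq_ltn_trans IH (kS i).
pose i0 := maxn I K.
have cover m : (k i0 <= m)%N -> exists i, (i0 <= i)%N && (k i <= m < k i.+1)%N.
  elim: m => [|m IH].
    rewrite leqn0 => /eqP k0; exists i0; rewrite leqnn k0 /=.
    by rewrite (leq_ltn_trans _ (kS i0)).
  rewrite leq_eqVlt => /predU1P[<-|]; first by exists i0; rewrite !leqnn kS.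
  rewrite ltnS => /IH[i /andP[i0i /andP[ki im]]].
  have [mi|im'] := ltnP m.+1 (k i.+1); first by exists i; rewrite i0i mi leqW.
  exists i.+1; rewrite (leqW i0i) im' /=.
  by apply: leq_ltn_trans (kS i.+1).
exists (k i0) => // m /= /cover[i /andP[i0i /andP[ki im]]].
have Ii : (I <= i)%N by rewrite (leq_trans _ i0i)// leq_maxl.
have Kk : (K <= k i)%N by rewrite (leq_trans _ (kge i))// (leq_trans _ i0i)// leq_maxr.
have := HI i Ii; rewrite /= => xik.
have -> : xs - x m = (xs - x (k i)) - (x (k i + (m - k i))%N - x (k i)).
  by rewrite subnKC// opprB addrA subrK.
rewrite (le_lt_trans (ler_normB _ _))// [ltRHS]splitr ltr_leD//.
rewrite (le_trans (step _ _ Kk))// mulrA ler_pdivrMr// mulrC ler_pM2l// ler_nat.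
by have := kb i; lia.
Qed.

End euclidean.

(** * Consequences of a single run of the algorithm *)

Section realization.
Context {R : realType} {n q : nat}.
Variables (F : 'rV[R]_n -> 'rV[R]_q -> R) (C : R).
Hypothesis CF : forall x z, C <= F x z.

Lemma saa_ge (z : nat -> 'rV[R]_q) N x : (0 < N)%N -> C <= saa F z N x.
Proof.
move=> N0; rewrite /saa ler_pdivlMl ?ltr0n//.
apply: (@le_trans _ _ (\sum_(i < N) C)); last exact: ler_sum.
by rewrite sumr_const card_ord mulr_natl.
Qed.

Variables (h : nat -> R) (r beta gamma gammabar mB MB : R).
Variables (x0 : 'rV[R]_n) (N0 : nat) (theta0 : R).
Variables (x : nat -> 'rV[R]_n) (N Nt : nat -> nat) (theta alpha : nat -> R).
Variables (p : nat -> 'rV[R]_n) (z zt : nat -> nat -> 'rV[R]_q).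
Hypothesis run : IR_NS F h r beta gamma gammabar mB MB x0 N0 theta0
  x N Nt theta alpha p z zt.
Hypothesis hN0 : (0 < N0)%N.
Hypothesis h_ge0 : forall N, (0 < N)%N -> 0 <= h N.
Hypothesis h_decr : forall M N, (0 < M)%N -> (M < N)%N -> h N < h M.
Hypotheses (hbeta : 0 < beta) (hgamma : 0 < gamma).
Variables (alphabar C1 : R).
Hypothesis halphabar : 0 < alphabar.
Hypothesis halpha : forall k, alphabar <= alpha k.
Hypothesis hsum : (\sum_(0 <= k <oo) (h (N k))%:E <= C1%:E)%E.

Lemma sample_size_gt0 k : (0 < N k)%N.
Proof.
case: k => [|k]; first by have [_ -> _] := S0_init run.
by have /andP[] := S3_sizes run k.
Qed.

Lemma sum_h_le K : \sum_(k < K) h (N k) <= C1.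
Proof.
rewrite -lee_fin -sumEFin; apply: le_trans hsum.
have := @nneseries_lim_ge R (fun k => (h (N k))%:E) xpredT 0 K.
rewrite big_mkord; apply => k _ _.
by rewrite lee_fin h_ge0// sample_size_gt0.
Qed.

(** Adding (i) and (R) cancels the value on the restoration sample, leaving a difference of
    consecutive values of [saa F (z k) (N k) (x k)], which telescopes. *)
Lemma sum_direction_le K :
  saa F (z K) (N K) (x K) + gamma * alphabar * \sum_(k < K) dot (p k) (p k)
    <= saa F (z 0) (N 0) (x 0) + beta * \sum_(k < K) h (N k).
Proof.
elim: K => [|K IH]; first by rewrite !big_ord0 !mulr0.
have [_ _] := S1_restoration run K; rewrite /condition_R => hR.
have := S3_i run K; rewrite -(S4_update run) sqr_norm2 => hi.
have ha : gamma * alphabar * dot (p K) (p K) <= gamma * alpha K * dot (p K) (p K).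
  by rewrite ler_wpM2r ?dot_ge0// ler_pM2l.
by rewrite !big_ord_recr /= !mulrDr; lra.
Qed.

Lemma direction_cvg0 : dot (p k) (p k) @[k --> \oo] --> 0.
Proof.
apply: cvg_series_cvg_0; apply: nondecreasing_is_cvgn.
  apply/nondecreasing_seqP => k; rewrite !seriesSr lerDl; exact: dot_ge0.
have ga : 0 < gamma * alphabar by rewrite mulr_gt0.
exists ((saa F (z 0) (N 0) (x 0) + beta * C1 - C) / (gamma * alphabar)) => _ [K _ <-].
rewrite /series /= big_mkord ler_pdivlMr// mulrC.
have := sum_direction_le K; have := saa_ge (z K) (x K) (sample_size_gt0 K).
have : beta * \sum_(k < K) h (N k) <= beta * C1 by rewrite ler_pM2l// sum_h_le.
lra.
Qed.

(** Summability sends [h (N k)] to 0, whereas strict decrease keeps [h] positive and bounded away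
    from 0 on sizes below [M]. *)
Lemma sample_size_large M : \forall k \near \oo, (M <= N k)%N.
Proof.
have hp m : (0 < m)%N -> 0 < h m.
  by move=> m0; apply: le_lt_trans (h_ge0 (ltn0Sn m)) (h_decr m0 (ltnSn m)).
have h0 : h (N k) @[k --> \oo] --> 0.
  apply: cvg_series_cvg_0; apply: nondecreasing_is_cvgn.
    apply/nondecreasing_seqP => k; rewrite !seriesSr lerDl.
    by rewrite h_ge0// sample_size_gt0.
  by exists C1 => _ [K _ <-]; rewrite /series /= big_mkord sum_h_le.
(* [M.+1] instead of [M], because [h] is constrained only at positive sizes. *)
have /cvgrPdist_lt/(_ _ (hp M.+1 isT)) := h0.
apply: filterS => k; rewrite sub0r normrN ger0_norm ?h_ge0 ?sample_size_gt0// => hk.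
rewrite leqNgt; apply/negP => NM; move: hk; apply/negP; rewrite -leNgt.
by rewrite ltW// h_decr ?sample_size_gt0// leqW.
Qed.

Lemma iterates_cvg xs : strictly_strong_accumulation_point x xs ->
  x k @[k --> \oo] --> xs.
Proof.
apply: strictly_strong_cvg; apply/cvgrPdist_lt => e e0.
have e20 : 0 < e ^+ 2 by rewrite exprn_gt0.
have /cvgrPdist_lt/(_ _ e20) := direction_cvg0.
apply: filterS => k; rewrite sub0r normrN (ger0_norm (dot_ge0 _)) => pe.
rewrite sub0r normrN (S4_update run) addrC addKr normrZ.
have /andP[a0 a1] := S3_step run k.
rewrite (gtr0_norm a0); apply: le_lt_trans (mx_norm_lt_dot e0 pe).
by rewrite ler_piMl.
Qed.

Hypothesis mB0 : 0 < mB.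

(** In the subgradient inequality at [x k], the subgradient is controlled by [p k] and tends to 0
    while [y - x k] stays bounded. *)
Lemma saa_lower_bound xs y : strictly_strong_accumulation_point x xs ->
  forall e, 0 < e -> \forall k \near \oo,
    saa F (z k.+1) (N k.+1) (x k) - e <= saa F (z k.+1) (N k.+1) y.
Proof.
move=> /iterates_cvg xxs e e0.
(* [b] bounds [y - x k] in the sup norm once [x k] is within 1 of [xs], and [D] bounds its squared
   Euclidean norm; the final [+ 1] keeps [D] positive even for [n = 0]. *)
pose b := `|y - xs| + 1; pose D := n%:R * b ^+ 2 + 1.
have D0 : 0 < D by rewrite ltr_wpDl// mulr_ge0// sqr_ge0.
have t0 : 0 < D / e by rewrite divr_gt0.
(* With Young weight [D / e], the term in [v] is at most [e], and [dot (p k) (p k) < e / c] makes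
   the term in [g] at most [e]. *)
pose c := D / e * (4 / mB ^+ 2).
have c0 : 0 < c by rewrite mulr_gt0// divr_gt0// exprn_gt0.
have ec0 : 0 < e / c by rewrite divr_gt0.
have /cvgrPdist_lt/(_ _ ec0) p_small := direction_cvg0.
have /cvgrPdist_lt/(_ _ ltr01) x_near := xxs.
near=> k.
have [B _ /(descent_direction_subgradient mB0)[g gsub gp]] := S3_direction run k.
have := gsub y; set v := y - x k => gy.
have pk : dot (p k) (p k) < e / c.
  rewrite -(ger0_norm (dot_ge0 (p k))) -normrN -sub0r.
  by near: k.
have vb : `|v| <= b.
  rewrite /v /b -(subrK xs y) -addrA (le_trans (ler_normD _ _))// subrK lerD2l ltW//.
  by near: k.
have vi (i : 'I_n) : `|v ord0 i| <= `|v|.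
  rewrite [leRHS](mx_normrE v).
  exact: (le_bigmax _ (fun ij : 'I_1 * 'I_n => `|v ij.1 ij.2|) (ord0, i)).
have vv : dot v v <= D.
  apply: (@le_trans _ _ (\sum_(i < n) b ^+ 2)).
    apply: ler_sum => i _; rewrite -expr2 -(real_normK (num_real (v ord0 i))).
    by rewrite ler_pXn2r ?nnegrE ?normr_ge0 ?(le_trans (vi i))// /b addr_ge0.
  by rewrite sumr_const card_ord -mulr_natl /D lerDl.
have := dot_ge g v t0.
have h1 : D / e * dot g g <= e.
  apply: (@le_trans _ _ (D / e * (4 / mB ^+ 2 * dot (p k) (p k)))).
    by rewrite ler_pM2l.
  by rewrite mulrA -/c mulrC -ler_pdivlMr// ltW.
have h2 : (D / e)^-1 * dot v v <= e.
  rewrite invf_div -ler_pdivlMl ?divr_gt0// invf_div.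
  by rewrite mulrVK// unitfE gt_eqF.
lra.
Unshelve. all: by end_near.
Qed.

End realization.

(** * The law of large numbers for the two test functions *)

Section frequently_close_averages.
Context {R : realType} {n q : nat} {d : measure_display} {T : measurableType d}.
Variables (P : probability T R) (xi : T -> 'rV[R]_q).
Variables (F : 'rV[R]_n -> 'rV[R]_q -> R) (C : R).
Hypothesis mxi : random_vector xi.
Hypothesis mF : forall x, measurable_fun setT (F x : borel R q -> R).
Hypothesis CF : forall x z, C <= F x z.
Variable zeta : nat -> nat -> T -> 'rV[R]_q.
Hypothesis iidz : forall k, iid_sample P xi (zeta k).

(** Both test functions are shifted by [C] to be nonnegative, as the uniform law requires; the shift
    of the second is undone, using that a constant averages to itself when [0 < N]. *)
Lemma frequently_close_averages (l i m : nat) (e : R) : 0 < e ->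
  P.-integrable setT (fun w => (F (rational_point l) (xi w))%:E) ->
  {ae P, forall w, exists M, forall K, exists2 k, (K <= k)%N &
    forall N, (M <= N)%N -> (0 < N)%N ->
      fine (\int[P]_w (cell_inf F C i m (xi w))%:E)%E - e
        <= N%:R^-1 * \sum_(j < N) cell_inf F C i m (zeta k j w) /\
      saa F (fun j => zeta k j w) N (rational_point l)
        <= fine (objective F P xi (rational_point l)) + e}.
Proof.
move=> e0 iF; set u := rational_point l.
pose psi (z : 'rV[R]_q) := F u z - C.
have mpsi : measurable_fun setT (psi : borel R q -> R).
  by apply: measurable_funB => //; exact: mF.
have mphi := measurable_cell_inf mF CF i m.
have E := excess_expectation C iF.
have iV : P.-integrable setT (EFin \o (cell_inf F C i m \o xi)).
  exact: integrable_cell_inf.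
have iW : P.-integrable setT (EFin \o (psi \o xi)).
  have iC : P.-integrable setT (cst C%:E) by exact: finite_measure_integrable_cst.
  by have := integrableB measurableT iF iC; apply: eq_integrable.
have := @ae_frequently_close _ _ _ P (cell_inf F C i m \o xi) (psi \o xi)
  (fun k j => cell_inf F C i m \o zeta k j) (fun k j => psi \o zeta k j) e.
move=> /(_ (measurableT_comp mphi mxi) (fun w => cell_inf_ge0 CF _ _ _) iV).
move=> /(_ (measurableT_comp mpsi mxi)).
have psi0 z : 0 <= psi z by rewrite subr_ge0.
move=> /(_ (fun w => psi0 _) iW).
move=> /(_ (fun k => pairwise_iid_comp mphi (iid_sample_pairwise (iidz k)))).
move=> /(_ (fun k j w => cell_inf_ge0 CF _ _ _)).
move=> /(_ (fun k => pairwise_iid_comp mpsi (iid_sample_pairwise (iidz k)))).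
move=> /(_ (fun k j w => psi0 _) e0).
apply: filterS => w [M HM]; exists M => K; have [k Kk Hk] := HM K; exists k => // N MN N0.
have [] := Hk N MN; rewrite ler_norml => /andP[h1 _]; rewrite ler_norml => /andP[_ h2].
split; first by move: h1; rewrite /comp; lra.
have objfin : objective F P xi u \is a fin_num.
  by rewrite /objective unlock; exact: integrable_fin_num.
move: h2; rewrite /comp E fineB//= /psi.
rewrite big_split /= sumr_const card_ord mulrDr -/(saa F (fun j => zeta k j w) N u).
rewrite -[(- C) *+ N]mulr_natl mulKf ?pnatr_eq0 -?lt0n//.
lra.
Qed.

End frequently_close_averages.

(** * Optimality of strictly strong accumulation points *)

Unset Implicit Arguments.
Set Strict Implicit.
Set Printing Implicit Defensive.

Theorem theorem3p2
  (R : realType) (n q : nat)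
  (d : measure_display) (Omega : measurableType d) (P : probability Omega R)
  (xi : Omega -> 'rV[R]_q) (hxi : random_vector xi)
  (F : 'rV[R]_n -> 'rV[R]_q -> R)
  (hFmeas : forall x, measurable_fun setT (F x : borel R q -> R))
  (h : nat -> R)
  (h_ge0 : forall N, (0 < N)%N -> 0 <= h N)
  (h_decr : forall M N, (0 < M)%N -> (M < N)%N -> h N < h M)
  (h_lim : h N @[N --> \oo] --> (0 : R))
  (* parameters of the algorithm and constants of the assumptions *)
  (x0 : 'rV[R]_n) (N0 : nat) (hN0 : (0 < N0)%N)
  (theta0 r beta gamma gammabar : R)
  (htheta0 : 0 < theta0 < 1) (hr : 0 < r < 1)
  (hbeta : 0 < beta) (hgamma : 0 < gamma) (hgammabar : 0 < gammabar)
  (mB MB C C0 C1 : R)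
  (* the random processes *)
  (x : nat -> Omega -> 'rV[R]_n) (N Nt : nat -> Omega -> nat)
  (theta alpha : nat -> Omega -> R) (p : nat -> Omega -> 'rV[R]_n)
  (zeta zetat : nat -> nat -> Omega -> 'rV[R]_q)
  (hx : forall k, random_vector (x k))
  (hN : forall k, measurable_fun setT (N k))
  (hNt : forall k, measurable_fun setT (Nt k.+1))
  (hzeta : forall k, iid_sample P xi (zeta k))
  (hzetat : forall k, iid_sample P xi (zetat k.+1))
  (halg : forall w,
    IR_NS F h r beta gamma gammabar mB MB x0 N0 theta0
      (x ^~ w) (N ^~ w) (Nt ^~ w) (theta ^~ w) (alpha ^~ w) (p ^~ w)
      (fun k i => zeta k i w) (fun k i => zetat k i w))
  (* E[f_{Nt_{k+1}}(x_k) | F_k] = f(x_k) and E[f_{N_{k+1}}(x_k) | F_k] = f(x_k) *)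
  (hcondt : forall k, is_cond_expectation P (natural_filtration x k)
    (fun w => (saa F (fun i => zetat k.+1 i w) (Nt k.+1 w) (x k w))%:E)
    (fun w => objective F P xi (x k w)))
  (hcond : forall k, is_cond_expectation P (natural_filtration x k)
    (fun w => (saa F (fun i => zeta k.+1 i w) (N k.+1 w) (x k w))%:E)
    (fun w => objective F P xi (x k w)))
  (A1 : assumption_A1 F C)
  (A2 : assumption_A2 F mB MB)
  (A3 : forall w k, condition_R F h beta (x ^~ w) (N ^~ w) (Nt ^~ w)
    (fun k i => zeta k i w) (fun k i => zetat k i w) k)
  (A4 : assumption_A4 P F xi)
  (hC0 : {ae P, forall w, F x0 (xi w) <= C0})
  (hC1 : 0 < C1)
  (hsum : {ae P, forall w, (\sum_(0 <= k <oo) (h (N k w))%:E <= C1%:E)%E})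
  (A5 : assumption_A5 P F xi
    [set y | (objective F P xi y <= (C0 + 2 * beta * C1)%:E)%E])
  (alphabar : R) (halphabar : 0 < alphabar)
  (halpha : forall k w, alphabar <= alpha k w) :
  {ae P, forall w, forall xs : 'rV[R]_n,
    strictly_strong_accumulation_point (x ^~ w) xs ->
    objective F P xi xs = ereal_inf (range (objective F P xi))}.
Proof.
have CF y z : C <= F y z by have [] := A1 z.
have cF z : continuous (F ^~ z) by have [] := A1 z.
have mB0 : 0 < mB by case: A2 => /andP[].
have hC : 0 <= beta * C1 by rewrite mulr_ge0// ltW.
have x0C : (objective F P xi x0 <= C0%:E)%E.
  (* A single outcome satisfying the almost sure bound yields [C <= C0], so the constant [C0 - C] is
     nonnegative. *)
  have [w0 Cw0] : exists w, F x0 (xi w) <= C0.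
    apply: contrapT => nw; have [A [mA PA0 nA]] := hC0.
    have AT : A = setT.
      by apply/seteqP; split => // w _; apply: nA => /= Fw; apply: nw; exists w.
    by move: PA0; rewrite AT probability_setT => /eqP; rewrite onee_eq0.
  have E : (\int[P]_w (F x0 (xi w) - C)%:E <= (C0 - C)%:E)%E.
    rewrite -[leRHS]mule1 -[X in (_ * X)%E](probability_setT P) -integral_cst//.
    apply: ae_ge0_le_integral => //.
    - by move=> w _; rewrite lee_fin subr_ge0.
    - apply/measurable_EFinP; apply: measurable_funB => //.
      exact: measurable_objective.
    - by move=> w _; rewrite lee_fin subr_ge0 (le_trans (CF x0 (xi w0))).
    - by apply: filterS hC0 => w Fw _; rewrite lee_fin lerB.
  have iF0 : P.-integrable setT (fun w => (F x0 (xi w))%:E).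
    apply: (integrable_of_excess hxi hFmeas CF).
    by rewrite (le_lt_trans E)// ltry.
  by move: E; rewrite excess_expectation// EFinB leeD2rE.
(* The indices range over [nat], so one null set serves all test functions, although the choice
   among them will depend on [w] through [xs]. *)
have good : {ae P, forall w (l i m j : nat),
    P.-integrable setT (fun w => (F (rational_point l) (xi w))%:E) ->
    exists M, forall K, exists2 k, (K <= k)%N &
    forall N, (M <= N)%N -> (0 < N)%N ->
      fine (\int[P]_w (cell_inf F C i m (xi w))%:E)%E - j.+1%:R^-1
        <= N%:R^-1 * \sum_(j < N) cell_inf F C i m (zeta k.+1 j w) /\
      saa F (fun j => zeta k.+1 j w) N (rational_point l)
        <= fine (objective F P xi (rational_point l)) + j.+1%:R^-1}.
  apply: ae_foralln => l; apply: ae_foralln => i; apply: ae_foralln => m.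
  apply: ae_foralln => j.
  have [iF|nF] := pselect (P.-integrable setT (fun w => (F (rational_point l) (xi w))%:E)); last first.
    by apply: aeW => w /nF.
  have j0 : 0 < j.+1%:R^-1 :> R by rewrite invr_gt0.
  apply: filterS (frequently_close_averages hxi hFmeas CF (fun k => hzeta k.+1) i m j0 iF).
  by move=> w Hw _.
apply: filterS2 hsum good => w hsumw goodw xs acc.
have run := halg w.
apply/eqP; rewrite eq_le; apply/andP; split; last first.
  by apply: ereal_inf_lbound; exists xs.
apply: le_ereal_inf_tmp => _ [y _ <-]; rewrite leNgt; apply/negP => yxs.
have [y' [y'xs y'C]] : exists y', (objective F P xi y' < objective F P xi xs)%E /\
    (objective F P xi y' <= (C0 + 2 * beta * C1)%:E)%E.
  have C0le : (C0%:E <= (C0 + 2 * beta * C1)%:E)%E.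
    by rewrite lee_fin lerDl -mulrA mulr_ge0.
  have [xsC|Cxs] := leP (objective F P xi xs) C0%:E.
    by exists y; split => //; rewrite ltW// (lt_le_trans yxs)// (le_trans xsC).
  by exists x0; split; [exact: le_lt_trans Cxs|exact: le_trans C0le].
have [D0 [G [oD0 _ DD0 iG FG]]] := A5.
have [l [iF]] := rational_point_below hxi hFmeas cF oD0 (DD0 _ y'C) iG FG y'xs.
set u := rational_point l => uxs.
have objfin : objective F P xi u \is a fin_num.
  by rewrite /objective unlock; exact: integrable_fin_num.
pose v := fine (objective F P xi u).
(* A real level strictly between the two objective values, found also when the objective is infinite
   at [xs]. *)
have [b vb bxs] : exists2 b, v < b & (b%:E < objective F P xi xs)%E.
  move: uxs; rewrite -(fineK objfin) -/v.
  case: (objective F P xi xs) => [s| |] //.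
    by rewrite lte_fin => vs; exists ((v + s) / 2); rewrite ?lte_fin; lra.
  by exists (v + 1); rewrite ?ltry//; lra.
have [i [m [xsball phib]]] :=
  cell_inf_expectation hFmeas cF CF hxi (excess_expectation_gt hxi hFmeas CF bxs).
have {phib} phib : b - C < fine (\int[P]_w0 (cell_inf F C i m (xi w0))%:E)%E.
  rewrite -lte_fin fineK//; apply: integrable_fin_num => //.
  exact: (integrable_cell_inf hFmeas CF).
(* Three errors will add up, namely two averages and the subgradient slack; at a quarter of the gap
   each, they cannot fill it. *)
have e0 : 0 < (b - v) / 4 by rewrite divr_gt0// subr_gt0.
pose j := Num.truncn ((b - v) / 4)^-1.
have je : j.+1%:R^-1 <= (b - v) / 4.
  by rewrite invf_ple ?posrE// ltW// Num.Theory.truncnS_gt.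
have [M HM] := goodw l i m j iF.
have xxs := iterates_cvg CF run hN0 h_ge0 hbeta hgamma halphabar (halpha ^~ w) hsumw acc.
have [K1 _ HK1] := sample_size_large run hN0 h_ge0 h_decr hsumw M.
have [K2 _ HK2] := saa_lower_bound CF run hN0 h_ge0 hbeta hgamma halphabar
  (halpha ^~ w) hsumw mB0 u acc e0.
have [K3 _ HK3] : \forall k \near \oo, ball (rational_point i) m.+1%:R^-1 (x k w).
  by apply: xxs; exact: open_nbhs_nbhs (conj (ball_open _ _) xsball).
have [k kK Hk] := HM (maxn K1 (maxn K2 K3)).
move: kK; rewrite !geq_max => /and3P[k1 k2 k3].
have Nk0 : (0 < N k.+1 w)%N by exact: (sample_size_gt0 run hN0 k.+1).
have [low up] := Hk (N k.+1 w) (HK1 k.+1 (leqW k1)) Nk0.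
have saa_low := HK2 k k2.
(* The iterate [x k] may depend on the sample, but the cell is fixed in advance and contains [x k],
   so the bound holds sample by sample. *)
have cell_le : (N k.+1 w)%:R^-1 * \sum_(j < N k.+1 w) cell_inf F C i m (zeta k.+1 j w)
    <= saa F (fun j => zeta k.+1 j w) (N k.+1 w) (x k w) - C.
  rewrite /saa (_ : _ - C = (N k.+1 w)%:R^-1
    * \sum_(j < N k.+1 w) (F (x k w) (zeta k.+1 j w) - C)); last first.
    by rewrite sumrB sumr_const card_ord mulrBr -[C *+ _]mulr_natl mulKf// pnatr_eq0 -lt0n.
  rewrite ler_pM2l ?invr_gt0 ?ltr0n//.
  by apply: ler_sum => a _; apply: (cell_inf_le cF CF); exact: HK3.
rewrite -/u in up saa_low; rewrite -/v in up.
have := le_trans low cell_le; have := le_trans saa_low up.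
move: phib je vb; rewrite /=.
move: (saa F _ _ _) (fine _) (j.+1%:R^-1) => a c t.
lra.
Qed.
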